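(* Let $(h_{i,\alpha}: i\in[n],\ \alpha\in\mathbb{Z}_{\ge0}^n\setminus\{0\})$ be complex numbers such that, with $A=(A_{i,j})_{1\le i,j\le n}$, $A_{i,j}:=h_{i,\mathbf{e}_j}$, the series $\sum_{k=0}^\infty A^k$ converges, and such that the power series mapping $F=(F_1,\dots,F_n)$, $F_i(X_1,\dots,X_n):=X_i-\sum_{\alpha\ne0}h_{i,\alpha}X^\alpha$, converges in an open neighbourhood of the origin in $\mathbb{C}^n$. Then $F$ has an analytic inverse $F^{-1}=(F^{-1}_1,\dots,F^{-1}_n)$ near the origin with $$F_i^{-1}(X_1,\dots,X_n)=\sum_{\alpha\ne0}g_{i,\alpha}X^\alpha,\qquad g_{i,\alpha}:=\sum_{\mathcal{T}\in\vec{\mathbb{S}}_{i,\alpha}}\ \prod_{v\text{ internal vertex of }\mathcal{T}}h_{\tau(v),\mu(v)},$$ where the sums defining $g_{i,\alpha}$ converge.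
   Context: Multi-index notation: for $\alpha\in\mathbb{Z}_{\ge0}^n$, $X^\alpha=X_1^{\alpha_1}\cdots X_n^{\alpha_n}$; $\mathbf{e}_j$ is the multi-index with $1$ in position $j$ and $0$ elsewhere. An $n$-type tree $\mathcal{T}=(T,\tau)$ is a finite rooted planar tree $T=(V,E)$ (any finite number of children per vertex, ordered left to right) with a type function $\tau:V\to[n]$. It is ordered if, among the children of any vertex, children of smaller type lie to the left of children of larger type. A vertex is internal if it has at least one child, otherwise a leaf. For an internal vertex $v$, $\mu(v)\in\mathbb{Z}_{\ge0}^n$ has $j$-th component the number of type-$j$ children of $v$. $\mathrm{Leaftype}(\mathcal{T})\in\mathbb{Z}_{\ge0}^n$ has $j$-th component the number of type-$j$ leaves. $\vec{\mathbb{S}}_{i,\alpha}$ is the set of ordered $n$-type trees with root type $i$ and leaf type $\alpha$ (this includes the single-vertex tree when $\alpha=\mathbf{e}_i$, with empty product $1$).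
   Formalization: The sums over trees defining g need not converge as unordered sums (e.g. A with rows (2,-2),(2,-2), where A²=0); here g is the limit, as N→∞, of the finite sums over trees with at most N vertices. *)

(* Defs.v *)
From HB Require Import structures.
From mathcomp Require Import all_boot all_order all_algebra.
From mathcomp Require Import complex.
From mathcomp Require Import all_classical all_reals all_analysis.

Set Implicit Arguments.
Unset Strict Implicit.
Unset Printing Implicit Defensive.

Import Order.TTheory GRing.Theory Num.Theory.
Local Open Scope classical_set_scope.
Local Open Scope ring_scope.

(* The usual (norm) topology on C = R[i]. *)
HB.instance Definition _ (R : rcfType) := PseudoPointedMetric.copy R[i] (R[i])^o.

(* Multi-indices in Z_{>=0}^n (coordinates indexed by 'I_n, i.e. the
   paper's [n] = {1..n} shifted to {0..n-1}).                           *)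
Definition mi (n : nat) := {ffun 'I_n -> nat}.

Definition mi_e (n : nat) (j : 'I_n) : mi n := [ffun k => nat_of_bool (k == j)].
Definition mi0 (n : nat) : mi n := [ffun => 0%N].
Definition mi_deg (n : nat) (a : mi n) : nat := (\sum_(j < n) a j)%N.

Definition mono (R : rcfType) (n : nat) (x : 'I_n -> R[i]) (a : mi n) : R[i] :=
  \prod_(j < n) x j ^+ a j.

(* n-type rooted planar trees: a vertex carries its type and the ordered
   (left-to-right) list of its children.                               *)
Inductive ntree (n : nat) : Type := Node of 'I_n & seq (ntree n).

HB.instance Definition _ (n : nat) := gen_eqMixin (ntree n).
HB.instance Definition _ (n : nat) := gen_choiceMixin (ntree n).

Definition ntype (n : nat) (t : ntree n) : 'I_n := let: Node k _ := t in k.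

Fixpoint ordered (n : nat) (t : ntree n) : bool :=
  let: Node _ ts := t in
  sorted (fun u v : ntree n => (ntype u <= ntype v)%N) ts && all (@ordered n) ts.

Fixpoint nverts (n : nat) (t : ntree n) : nat :=
  let: Node _ ts := t in (sumn (map (@nverts n) ts)).+1.

Fixpoint nleaves (n : nat) (j : 'I_n) (t : ntree n) : nat :=
  let: Node k ts := t in
  if ts is [::] then nat_of_bool (k == j) else sumn (map (nleaves j) ts).

Definition leaftype (n : nat) (t : ntree n) : mi n := [ffun j => nleaves j t].

(* mu(v) for an internal vertex with children list ts *)
Definition mu (n : nat) (ts : seq (ntree n)) : mi n :=
  [ffun j => count (fun c => ntype c == j) ts].

Fixpoint tweight (R : rcfType) (n : nat) (h : 'I_n -> mi n -> R[i]) (t : ntree n)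
    : R[i] :=
  let: Node k ts := t in
  if ts is [::] then 1
  else h k (mu ts) * foldr (fun c acc => tweight h c * acc) 1 ts.

Definition Strees (n : nat) (i : 'I_n) (a : mi n) : set (ntree n) :=
  [set t | ordered t /\ ntype t = i /\ leaftype t = a].

(* partial sum of the tree series for g_{i,alpha}: all trees of
   \vec{S}_{i,alpha} with at most N vertices (a finite set). *)
Definition gpart (R : rcfType) (n : nat) (h : 'I_n -> mi n -> R[i])
    (i : 'I_n) (a : mi n) (N : nat) : R[i] :=
  \sum_(t \in [set t | Strees i a t /\ (nverts t <= N)%N]) tweight h t.

Definition Amat (R : rcfType) (n : nat) (h : 'I_n -> mi n -> R[i]) : 'M[R[i]]_n :=
  \matrix_(i, j) h i (mi_e j).

Definition abs_summable (R : rcfType) (n : nat) (u : mi n -> R[i]) : Prop :=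
  exists M : R, forall s : seq (mi n), uniq s -> \sum_(a <- s) `|u a| <= (M%:C)%C.

Definition psum (R : rcfType) (n : nat) (c : mi n -> R[i]) (x : 'I_n -> R[i])
    (N : nat) : R[i] :=
  \sum_(a \in [set a : mi n | (mi_deg a <= N)%N]) c a * mono x a.

Definition ps_conv (R : rcfType) (n : nat) (c : mi n -> R[i]) (x : 'I_n -> R[i]) :=
  abs_summable (fun a => c a * mono x a).

(* its value (meaningful when ps_conv c x holds) *)
Definition ps_val (R : realType) (n : nat) (c : mi n -> R[i]) (x : 'I_n -> R[i])
    : R[i] := lim (psum c x @ \oo).

Definition nz (R : rcfType) (n : nat) (c : mi n -> R[i]) : mi n -> R[i] :=
  fun a => if a == mi0 n then 0 else c a.

Definition Fmap (R : realType) (n : nat) (h : 'I_n -> mi n -> R[i])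
    (x : 'I_n -> R[i]) (i : 'I_n) : R[i] := x i - ps_val (nz (h i)) x.

Definition Gmap (R : realType) (n : nat) (g : 'I_n -> mi n -> R[i])
    (x : 'I_n -> R[i]) (i : 'I_n) : R[i] := ps_val (nz (g i)) x.

Definition polydisc (R : rcfType) (n : nat) (r : R) : set ('I_n -> R[i]) :=
  [set x | forall j, `|x j| < (r%:C)%C].

(* Main.v *)
(* Mark every vertex of a tree by an extra variable u.  The generating functions
   T_i(u, X) of the ordered trees satisfy T = u (X + A T + Q(T)), where Q collects
   the terms of degree at least 2, so T = sum_l u^(l+1) A^l (X + Q(T)).  Convergence
   of sum_k A^k makes |A^k| decay geometrically, so the l^1 norm of
   sum_l u^(l+1) A^l is finite even at some u0 > 1; as Q is quadratically small,
   the weighted l^1 norms of the polynomials T^(d) built in d rounds of grafting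
   are bounded uniformly in d.  All T^(d) with d >= N have the same coefficients at
   u^k for k <= N, so at u = 1 their tails are O(u0^-N): the tree sums converge, the
   values T^(d)(1, x) tend to G(x), and the recursion passes to the limit as
   F(G(x)) = x.  Finally F is injective near 0, whence G(F(y)) = y. *)

Require Import Defs.
From HB Require Import structures.
From mathcomp Require Import all_boot all_order all_algebra.
From mathcomp Require Import complex.
From mathcomp Require Import all_classical all_reals all_analysis.
From mathcomp Require Import zify ring lra.
From mathcomp Require mpoly.
Import (canonicals, coercions) mpoly.
Import Order.TTheory GRing.Theory Num.Theory.
Import numFieldNormedType.Exports.
Local Open Scope classical_set_scope.
Local Open Scope ring_scope.

Set Implicit Arguments.
Unset Strict Implicit.
Unset Printing Implicit Defensive.

(** The obstacle is the linear part. Only the powers of [A] become small: the matrix of moduli of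
    its entries may have spectral radius above 1, as for the rows (a, a) and (-a, -a) with a large,
    whose square is 0. Chains of unary vertices give infinitely many trees with the same leaf type,
    and their weights need not be absolutely summable, so cancellation must take place before any
    modulus is taken. Hence the linear part of the recursion is unrolled algebraically, and norms
    are applied only to entries of the powers of [A]. The recursion truncates trees by rounds of
    grafting, whereas [gpart] truncates by number of vertices. A bound at some u0 > 1 reconciles the
    two, because it penalises large trees after those with equal vertex count and leaf type have
    been added up. The bound is needed both for polynomials, where an l^1 norm controls all
    coefficients at once, and for their values at a point; it is therefore proved once, for a
    seminorm on an arbitrary commutative algebra. *)

(** * Real-valued modulus and limits of complex sequences *)

Section ComplexNorm.
Context {R : realType}.
Implicit Types z w : R[i].

(** The norm of [R[i]] takes its values in [R[i]], whose order is partial; a modulus in [R] gives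
    access to the total order and to [lra]. *)
Definition cn z : R := ComplexField.Normc.normc z.

Lemma normCE z : `|z| = (cn z)%:C%C.
Proof. by case: z. Qed.

Lemma lecR2 (a b : R) : (a%:C <= b%:C)%C = (a <= b).
Proof. by rewrite lecE /= eqxx. Qed.

Lemma ltcR2 (a b : R) : (a%:C < b%:C)%C = (a < b).
Proof. by rewrite ltcE /= eqxx. Qed.

Lemma le_normC z (b : R) : (`|z| <= b%:C%C) = (cn z <= b).
Proof. by rewrite normCE lecR2. Qed.

Lemma lt_normC z (b : R) : (`|z| < b%:C%C) = (cn z < b).
Proof. by rewrite normCE ltcR2. Qed.

Lemma cn0 : cn 0 = 0.
Proof. by rewrite /cn ComplexField.Normc.normc0. Qed.

Lemma cn1 : cn 1 = 1.
Proof. by rewrite /cn ComplexField.Normc.normc1. Qed.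

Lemma cn_eq0 z : cn z = 0 -> z = 0.
Proof. exact: ComplexField.Normc.eq0_normc. Qed.

Lemma cnM z w : cn (z * w) = cn z * cn w.
Proof. exact: ComplexField.Normc.normcM. Qed.

Lemma cn_ge0 z : 0 <= cn z.
Proof. by rewrite -lecR2 -normCE; exact: normr_ge0. Qed.

Lemma cnD z w : cn (z + w) <= cn z + cn w.
Proof. by rewrite -lecR2 rmorphD /= -!normCE ler_normD. Qed.

Lemma cnN z : cn (- z) = cn z.
Proof. by apply: (@complexI R); rewrite /= -!normCE normrN. Qed.

Lemma cnB z w : cn (z - w) <= cn z + cn w.
Proof. by rewrite -[cn w]cnN cnD. Qed.

Lemma cn_distC z w : cn (z - w) = cn (w - z).
Proof. by rewrite -cnN opprB. Qed.

Lemma cn_distD v z w : cn (z - w) <= cn (z - v) + cn (v - w).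
Proof. by rewrite (le_trans _ (cnD _ _))// addrA subrK. Qed.

Lemma cnX z k : cn (z ^+ k) = cn z ^+ k.
Proof. by elim: k => [|k IH]; rewrite ?expr0 ?cn1// !exprS cnM IH. Qed.

Lemma cn_sum (I : Type) (s : seq I) (P : pred I) (F : I -> R[i]) :
  cn (\sum_(k <- s | P k) F k) <= \sum_(k <- s | P k) cn (F k).
Proof.
elim/big_rec2: _ => [|k b a _ ab]; first by rewrite cn0.
by rewrite (le_trans (cnD _ _))// lerD2l.
Qed.

Lemma cn_real (x : R) : cn x%:C%C = `|x|.
Proof. by rewrite /cn /= expr0n /= addr0 sqrtr_sqr. Qed.

Lemma cn_ge_Re z : `|complex.Re z| <= cn z.
Proof. by rewrite -lecR2 -normCE; exact: normc_ge_Re. Qed.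

Lemma cn_ge_Im z : `|complex.Im z| <= cn z.
Proof.
case: z => a b; rewrite /cn /= -sqrtr_sqr ler_sqrt ?lerDr ?sqr_ge0//.
by rewrite addr_ge0 ?sqr_ge0.
Qed.

Lemma cn_le_ReIm z : cn z <= `|complex.Re z| + `|complex.Im z|.
Proof.
case: z => a b /=; rewrite -[leRHS]ger0_norm ?addr_ge0// -sqrtr_sqr.
rewrite ler_sqrt ?sqr_ge0// -(real_normK (num_real a)) -(real_normK (num_real b)).
by rewrite sqrrD addrAC lerDl mulrn_wge0// mulr_ge0.
Qed.

Lemma cvgCP (f : nat -> R[i]) (l : R[i]) :
  f @ \oo --> l <->
  forall e : R, 0 < e -> exists N, forall k, (N <= k)%N -> cn (f k - l) <= e.
Proof.
have cvo : f @ \oo --> l <-> forall e : R[i], 0 < e ->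
    \forall k \near \oo, `|(l : R[i]^o) - f k| <= e.
  exact: (@cvgrPdist_le R[i] R[i]^o nat \oo _ f l).
split=> [/cvo fl e e0|fl].
  have /fl[N _ HN] : 0 < e%:C%C :> R[i] by rewrite ltcR2.
  by exists N => k Nk; rewrite cn_distC -le_normC; exact: HN.
apply/cvo => e e0.
(* A positive element of [R[i]] is a positive real. *)
have [re0 ie0] : 0 < complex.Re e /\ complex.Im e = 0.
  by move: e0; rewrite ltcE /= => /andP[/eqP -> ->].
have [N HN] := fl _ re0.
exists N => // k /= Nk; rewrite normCE cn_distC.
by rewrite lecE /= ie0 eqxx /= HN.
Qed.

Lemma cvgRP (f : nat -> R) (l : R) :
  f @ \oo --> l <->
  forall e : R, 0 < e -> exists N, forall k, (N <= k)%N -> `|f k - l| <= e.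
Proof.
split=> [/cvgrPdist_le fl e e0|fl].
  by have [N _ HN] := fl _ e0; exists N => k Nk; rewrite distrC; exact: HN.
apply/cvgrPdist_le => e e0; have [N HN] := fl _ e0.
by exists N => // k /= Nk; rewrite distrC HN.
Qed.

Lemma cauchyR (f : nat -> R) :
  (forall e : R, 0 < e -> exists N, forall k l, (N <= k)%N -> (N <= l)%N ->
     `|f k - f l| <= e) -> cvg (f @ \oo).
Proof.
move=> fC; apply/cauchy_cvgP/cauchy_exP => e e0.
have [N HN] := fC (e / 2) (divr_gt0 e0 (ltr0n _ 2)).
exists (f N), N => // k /= Nk; rewrite /ball /= (le_lt_trans (HN _ _ _ Nk))//.
lra.
Qed.

Lemma cauchyC (f : nat -> R[i]) :
  (forall e : R, 0 < e -> exists N, forall k l, (N <= k)%N -> (N <= l)%N ->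
     cn (f k - f l) <= e) -> exists L : R[i], f @ \oo --> L.
Proof.
move=> fC.
have cvRe : cvg ((fun k => complex.Re (f k)) @ \oo).
  apply: cauchyR => e /fC[N HN]; exists N => k l Nk Nl.
  apply: le_trans (HN _ _ Nk Nl); rewrite (le_trans _ (cn_ge_Re _))//.
  by case: (f k) (f l) => [? ?] [? ?].
have cvIm : cvg ((fun k => complex.Im (f k)) @ \oo).
  apply: cauchyR => e /fC[N HN]; exists N => k l Nk Nl.
  apply: le_trans (HN _ _ Nk Nl); rewrite (le_trans _ (cn_ge_Im _))//.
  by case: (f k) (f l) => [? ?] [? ?].
move: cvRe cvIm => /cvg_ex[a /cvgRP fa] /cvg_ex[b /cvgRP fb].
exists (Complex a b); apply/cvgCP => e e0.
have e2 : 0 < e / 2 by rewrite divr_gt0.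
have [[N1 H1] [N2 H2]] := (fa _ e2, fb _ e2).
exists (maxn N1 N2) => k; rewrite geq_max => /andP[/H1 Ha /H2 Hb].
rewrite (le_trans (cn_le_ReIm _))//.
case: (f k) Ha Hb => [? ?] /= Ha Hb; lra.
Qed.

Lemma cvgC_uniq (f : nat -> R[i]) (l l' : R[i]) :
  f @ \oo --> l -> f @ \oo --> l' -> l = l'.
Proof.
move=> /cvgCP fl /cvgCP fl'; apply/eqP; rewrite -subr_eq0; apply/eqP/cn_eq0.
apply/eqP; rewrite eq_le cn_ge0 andbT; apply/ler_addgt0Pr => e e0.
have e2 : 0 < e / 2 by rewrite divr_gt0.
have [[N1 H1] [N2 H2]] := (fl _ e2, fl' _ e2).
have {H1} := H1 _ (leq_maxl N1 N2); have {H2} := H2 _ (leq_maxr N1 N2).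
have := cn_distD (f (maxn N1 N2)) l l'; rewrite (cn_distC l (f _)); lra.
Qed.

Lemma cvgC_lim (f : nat -> R[i]) (l : R[i]) : f @ \oo --> l -> lim (f @ \oo) = l.
Proof.
move=> fl; have fcv : cvg (f @ \oo) by apply/cvg_ex; exists l.
exact: cvgC_uniq fcv fl.
Qed.

Lemma cvgC_le (f : nat -> R[i]) (l v : R[i]) (b : R) (N : nat) : f @ \oo --> l ->
  (forall k, (N <= k)%N -> cn (f k - v) <= b) -> cn (l - v) <= b.
Proof.
move=> /cvgCP fl fb; apply/ler_addgt0Pr => e /fl[N1 H1].
have {H1} := H1 _ (leq_maxl N1 N); have {fb} := fb _ (leq_maxr N1 N).
have := cn_distD (f (maxn N1 N)) l v; rewrite (cn_distC l (f _)); lra.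
Qed.

Lemma cvgC_sub (f g : nat -> R[i]) (l l' : R[i]) :
  f @ \oo --> l -> g @ \oo --> l' -> (fun k => f k - g k) @ \oo --> l - l'.
Proof.
move=> /cvgCP fl /cvgCP gl'; apply/cvgCP => e e0.
have e2 : 0 < e / 2 by rewrite divr_gt0.
have [[N1 H1] [N2 H2]] := (fl _ e2, gl' _ e2).
exists (maxn N1 N2) => k; rewrite geq_max => /andP[/H1 {}H1 /H2 {}H2].
have -> : f k - g k - (l - l') = (f k - l) - (g k - l') by ring.
by apply: le_trans (cnB _ _) _; lra.
Qed.

End ComplexNorm.

(** * Enumeration of multi-indices and of ordered trees *)

Lemma nverts_children (n : nat) i (ts : seq (ntree n)) t :
  t \in ts -> (nverts t < nverts (Node i ts))%N.
Proof.
by move=> /= tts; rewrite ltnS sumnE big_map (perm_big _ (perm_to_rem tts)) big_cons leq_addr.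
Qed.

(** The induction principle generated for [ntree] has no hypothesis on the members of the list of
    children; induction on [nverts] supplies it. *)
Lemma ntree_ind_mem (n : nat) (P : ntree n -> Prop) :
  (forall i ts, (forall t, t \in ts -> P t) -> P (Node i ts)) ->
  forall t, P t.
Proof.
move=> HP t; have [N] := ubnP (nverts t); elim: N t => // N IH [i ts] tN.
by apply: HP => c /(nverts_children i) cts; apply: IH; exact: leq_trans cts tN.
Qed.

Section MultiIndices.
Context {n : nat}.
Implicit Types a b : mi n.

Definition mis (d : nat) : seq (mi n) :=
  [seq a <- [seq [ffun j => nat_of_ord (f j)] | f : {ffun 'I_n -> 'I_d.+1}] |
     (mi_deg a <= d)%N].

Lemma mis_uniq d : uniq (mis d).
Proof.
apply: filter_uniq; rewrite map_inj_in_uniq ?enum_uniq// => f g _ _ /ffunP fg.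
by apply/ffunP => j; apply: val_inj; have := fg j; rewrite !ffunE.
Qed.

Lemma le_mi_deg a j : (a j <= mi_deg a)%N.
Proof. by rewrite /mi_deg (bigD1 j)//= leq_addr. Qed.

Lemma mem_mis d a : (a \in mis d) = (mi_deg a <= d)%N.
Proof.
rewrite mem_filter; case: leqP => //= ad.
apply/mapP; exists [ffun j => inord (a j)]; first by rewrite mem_enum.
apply/ffunP => j; rewrite !ffunE inordK// ltnS.
exact: leq_trans (le_mi_deg _ _) ad.
Qed.

Lemma mi_deg_e (j : 'I_n) : mi_deg (mi_e j) = 1%N.
Proof.
rewrite /mi_deg (bigD1 j)//= ffunE eqxx big1// => k kj.
by rewrite ffunE (negbTE kj).
Qed.

Lemma mi_deg0 : mi_deg (mi0 n) = 0%N.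
Proof. by rewrite /mi_deg big1// => k _; rewrite ffunE. Qed.

Lemma mi_deg_eq0 a : (mi_deg a == 0%N) = (a == mi0 n).
Proof.
apply/eqP/eqP => [a0|->]; last exact: mi_deg0.
apply/ffunP => j; rewrite ffunE; apply/eqP; rewrite -leqn0 -a0.
exact: le_mi_deg.
Qed.

Lemma mi_e_inj : injective (@mi_e n).
Proof.
move=> j k /ffunP/(_ j); rewrite !ffunE eqxx; by case: eqP.
Qed.

Lemma mi_deg_eq1 a : mi_deg a = 1%N -> exists j, a = mi_e j.
Proof.
move=> a1; have [j aj] : exists j, a j != 0%N.
  apply/existsP; rewrite -[X in is_true X]negbK negb_exists.
  apply/negP => /forallP a0; move: a1; rewrite /mi_deg big1// => j _.
  by have := a0 j; rewrite negbK => /eqP.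
exists j; move: a1; rewrite /mi_deg (bigD1 j)//=.
case aj1 : (a j) aj => [//|[|m]] _; rewrite ?addSn //= add0n => -[/eqP].
rewrite sum_nat_eq0 => /forall_inP a0; apply/ffunP => k; rewrite ffunE.
by case: (eqVneq k j) => [->//|/a0/eqP].
Qed.

(* The sorted list of the child types of a vertex with [mu = a]. *)
Definition sorted_types a : seq 'I_n :=
  flatten [seq nseq (a j) j | j <- enum 'I_n].

Lemma count_sorted_types a j : count (pred1 j) (sorted_types a) = a j.
Proof.
rewrite /sorted_types count_flatten -map_comp sumnE big_map big_enum /=.
rewrite (bigD1 j)//= count_nseq /= eqxx mul1n big1 ?addn0// => k kj.
by rewrite count_nseq /= (negbTE kj).
Qed.

Lemma size_sorted_types a : size (sorted_types a) = mi_deg a.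
Proof.
rewrite /sorted_types size_flatten /shape -map_comp sumnE big_map big_enum /=.
by apply: eq_bigr => j _; rewrite size_nseq.
Qed.

Lemma sorted_types_sorted a :
  sorted (fun i j : 'I_n => (i <= j)%N) (sorted_types a).
Proof.
have tr : transitive (fun i j : 'I_n => (i <= j)%N) by move=> ? ? ?; exact: leq_trans.
rewrite /sorted_types.
have : sorted (fun i j : 'I_n => (i <= j)%N) (enum 'I_n).
  have := iota_sorted 0 n; rewrite -val_enum_ord sorted_map.
  by apply: sub_sorted.
rewrite !(sorted_pairwise tr).
elim: (enum 'I_n) => //= j s IH /andP[js /IH {}IH].
rewrite pairwise_cat IH andbT; apply/andP; split.
  apply/allrelP => k l /nseqP[-> _] /flattenP[q /mapP[m ms ->]] /nseqP[-> _].
  exact: (allP js).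
elim: (a j) => //= m ->; rewrite andbT; apply/allP => k /nseqP[-> _].
exact: leqnn.
Qed.

(** A sorted list is determined by its multiplicities. Hence [mu] fixes the child types of an
    ordered vertex, and no multinomial coefficient enters the recursion. *)
Lemma sorted_typesP s a : sorted (fun i j : 'I_n => (i <= j)%N) s ->
  (forall j, count (pred1 j) s = a j) -> s = sorted_types a.
Proof.
move=> s_sorted s_count.
apply: (sorted_eq (leT := fun i j : 'I_n => (i <= j)%N)) => //.
- by move=> ? ? ?; exact: leq_trans.
- by move=> i j ij; apply: val_inj; apply/eqP; rewrite eqn_leq.
- exact: sorted_types_sorted.
- by apply/allP => j _ /=; rewrite s_count count_sorted_types.
Qed.

Lemma prod_sorted_types (V : comPzRingType) (x : 'I_n -> V) a :
  \prod_(j <- sorted_types a) x j = \prod_(j < n) x j ^+ a j.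
Proof.
rewrite /sorted_types big_flatten big_map big_enum /=; apply: eq_bigr => j _.
by rewrite big_nseq iter_mulr_1.
Qed.

End MultiIndices.

Section ProductLists.
Context {n : nat} {T : eqType}.
Implicit Types (F : 'I_n -> seq T) (s : seq 'I_n).

Definition prodlist F s : seq (seq T) :=
  foldr (fun j acc => [seq c :: cs | c <- F j, cs <- acc]) [:: [::]] s.

Lemma mem_prodlist F s ts :
  (ts \in prodlist F s) = all2 (fun j c => c \in F j) s ts.
Proof.
elim: s ts => [|j s IH] [|c ts] //=.
  by apply/allpairsP => -[[? ?] /= []].
rewrite -IH; apply/allpairsP/andP => [[[c' ts'] /= [? ? [-> ->]]] //|[cF tsP]].
by exists (c, ts).
Qed.

Lemma prodlist_uniq F s : (forall j, uniq (F j)) -> uniq (prodlist F s).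
Proof.
move=> Fu; elim: s => //= j s IH; apply: allpairs_uniq => // -[c cs] [c' cs'] _ _.
by case=> -> ->.
Qed.

Lemma big_prodlist (V : pzRingType) (f : T -> V) F s :
  \sum_(ts <- prodlist F s) \prod_(c <- ts) f c =
  \prod_(j <- s) \sum_(c <- F j) f c.
Proof.
elim: s => [|j s IH] /=; first by rewrite big_seq1 !big_nil.
rewrite big_allpairs_dep big_cons -IH big_distrl /=; apply: eq_bigr => c _.
by rewrite big_distrr /=; apply: eq_bigr => cs _; rewrite big_cons.
Qed.

End ProductLists.

Section OrderedTrees.
Context {n : nat}.
Implicit Types (t c : ntree n) (ts : seq (ntree n)) (i : 'I_n).

(* The trees reached after [d] rounds of grafting: they have height less than
   [d], and the vertices at depth [k] have at most [d - k] children. *)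
Fixpoint otrees (d : nat) (i : 'I_n) : seq (ntree n) :=
  if d is d'.+1 then
    [seq Node i ts | b <- mis d, ts <- prodlist (otrees d') (sorted_types b)]
  else [::].

Lemma otrees_type d i t : t \in otrees d i -> ntype t = i.
Proof. by case: d => //= d /allpairsPdep[b [ts [_ _ ->]]]. Qed.

Lemma prodlist_types d s ts :
  ts \in prodlist (otrees d) s -> map (@ntype n) ts = s.
Proof.
rewrite mem_prodlist; elim: s ts => [|j s IH] [|c ts] //= /andP[cj /IH ->].
by rewrite (otrees_type cj).
Qed.

Lemma mu_types ts b : map (@ntype n) ts = sorted_types b -> mu ts = b.
Proof.
move=> tsb; apply/ffunP => j; rewrite ffunE.
by rewrite -(count_sorted_types b) -tsb count_map.
Qed.

Lemma otrees_uniq d i : uniq (otrees d i).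
Proof.
elim: d i => //= d IH i.
apply: allpairs_uniq_dep => [|b _|]; [exact: mis_uniq|exact: prodlist_uniq|].
move=> x y /allpairsPdep[b [ts [_ /prodlist_types tsb xE]]].
move=> /allpairsPdep[b' [ts' [_ /prodlist_types tsb' yE]]]; subst x y => /= -[ts_eq].
subst ts'; have bb' : b = b' by rewrite -(mu_types tsb) (mu_types tsb').
by subst b'.
Qed.

Lemma otreesSP d i t :
  reflect (exists ts, [/\ t = Node i ts,
                          sorted (fun u v : ntree n => (ntype u <= ntype v)%N) ts,
                          (size ts <= d.+1)%N &
                          forall c, c \in ts -> c \in otrees d (ntype c)])
          (t \in otrees d.+1 i).
Proof.
apply: (iffP allpairsPdep) => [[b [ts [bd tsP ->]]]|[ts [-> so sz tsP]]].
  have tsb := prodlist_types tsP; exists ts; split=> //.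
  - have := sorted_types_sorted b; rewrite -tsb sorted_map.
    by apply: sub_sorted.
  - by rewrite -(size_map (@ntype n)) tsb size_sorted_types -mem_mis.
  move: tsP; rewrite mem_prodlist -tsb; elim: (ts) => //= c ts' IH /andP[cP /IH {}IH].
  by move=> c'; rewrite inE => /predU1P[->|/IH].
have tsb : map (@ntype n) ts = sorted_types (mu ts).
  apply: sorted_typesP => [|j]; last by rewrite count_map ffunE.
  by rewrite sorted_map; apply: sub_sorted so.
exists (mu ts), ts; split=> //.
  by rewrite mem_mis -size_sorted_types -tsb size_map.
rewrite mem_prodlist -tsb; elim: (ts) tsP => //= c ts' IH tsP.
by rewrite tsP ?mem_head// IH// => c' c's; apply: tsP; rewrite inE c's orbT.
Qed.

Lemma otrees_ordered d i t : t \in otrees d i -> ordered t.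
Proof.
elim: d i t => // d IH i t /otreesSP[ts [-> so _ tsP]] /=; rewrite so /=.
by apply/allP => c /tsP/IH.
Qed.

(** This links the two truncations. Every subtree has at least one vertex, so the number of vertices
    bounds both the number of children and the height. *)
Lemma mem_otrees d t : ordered t -> (nverts t <= d)%N -> t \in otrees d (ntype t).
Proof.
elim: d t => [|d IH] [i ts] // /andP[so /allP tso] tsd.
apply/otreesSP; exists ts; split=> //.
  apply: leq_trans tsd; rewrite /= leqW// sumnE big_map.
  by rewrite -sum1_size; apply: leq_sum => -[].
move=> c cts; apply: IH; first exact: tso.
by have := leq_trans (nverts_children i cts) tsd; rewrite ltnS.
Qed.

Lemma leaftype_neq0 t : leaftype t != mi0 n.
Proof.
suff /existsP[j tj] : [exists j, (0 < nleaves j t)%N].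
  by apply/eqP => /ffunP/(_ j); rewrite !ffunE; case: nleaves tj.
elim/ntree_ind_mem: t => i [_|c ts IH].
  by apply/existsP; exists i; rewrite /= eqxx.
have /existsP[j cj] := IH c (mem_head _ _).
by apply/existsP; exists j => /=; rewrite ltn_addr.
Qed.

End OrderedTrees.

(** * The recursion for tree sums in a commutative algebra *)

Section TreeSums.
Context {R : realType} {n : nat} (h : 'I_n -> mi n -> R[i]).
Context {V : comAlgType R[i]} (u : V) (x : 'I_n -> V).
Implicit Types (t c : ntree n) (i j : 'I_n).

(** Generic in [V], so as to serve with polynomial variables and with complex numbers. *)
Definition tree_term t : V :=
  tweight h t *: (u ^+ nverts t * \prod_(j < n) x j ^+ nleaves j t).

Definition tree_sum (d : nat) i : V := \sum_(t <- otrees d i) tree_term t.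

Lemma tree_term_leaf i : tree_term (Node i [::]) = u * x i.
Proof.
rewrite /tree_term /= scale1r expr1 (bigD1 i)//= eqxx expr1 big1 ?mulr1// => j.
by rewrite eq_sym => /negbTE ->.
Qed.

Lemma tree_term_node i (ts : seq (ntree n)) : ts != [::] ->
  tree_term (Node i ts) = h i (mu ts) *: (u * \prod_(c <- ts) tree_term c).
Proof.
move=> ts0; rewrite /tree_term.
have -> : tweight h (Node i ts) = h i (mu ts) * \prod_(c <- ts) tweight h c.
  by rewrite unlock /reducebig; case: ts ts0.
have -> : nverts (Node i ts) = (\sum_(c <- ts) nverts c).+1.
  by rewrite /= sumnE big_map.
have -> : \prod_(j < n) x j ^+ nleaves j (Node i ts) =
          \prod_(j < n) x j ^+ (\sum_(c <- ts) nleaves j c).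
  apply: eq_bigr => j _; congr (_ ^+ _).
  by rewrite -(big_map (nleaves j) xpredT id) -sumnE; case: ts ts0.
rewrite -scalerA exprS -mulrA scalerAr; congr (_ *: (_ * _)).
elim: (ts) => [|c ts' IH].
  rewrite !big_nil scale1r mul1r big1// => j _.
  by rewrite big_nil expr0.
have -> : \prod_(j < n) x j ^+ (\sum_(c <- c :: ts') nleaves j c) =
    \prod_(j < n) x j ^+ nleaves j c *
    \prod_(j < n) x j ^+ (\sum_(c <- ts') nleaves j c).
  by rewrite -big_split /=; apply: eq_bigr => j _; rewrite big_cons exprD.
rewrite !big_cons -IH exprD -scalerAl -scalerAr scalerA; congr (_ *: _).
by rewrite mulrACA.
Qed.

(** The summand b = 0 of [otrees] is the single-vertex tree, which contributes [x i]. For b <> 0 the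
    child types are forced, so the sum over lists of children factors. *)
Lemma tree_sumS d i :
  tree_sum d.+1 i =
  u * (x i + \sum_(b <- mis d.+1 | b != mi0 n)
               h i b *: \prod_(j < n) tree_sum d j ^+ b j).
Proof.
rewrite {1}/tree_sum [otrees _ _]/= big_allpairs_dep /=.
rewrite (bigD1_seq (mi0 n)) ?mis_uniq ?mem_mis ?mi_deg0//= mulrDr; congr (_ + _).
  have -> : sorted_types (mi0 n) = [::].
    by apply/size0nil; rewrite size_sorted_types mi_deg0.
  by rewrite /= big_seq1 tree_term_leaf.
rewrite mulr_sumr; apply: eq_bigr => b b0.
rewrite -scalerAr -prod_sorted_types -big_prodlist mulr_sumr scaler_sumr.
rewrite !big_seq; apply: eq_bigr => ts /prodlist_types tsb.
rewrite tree_term_node ?(mu_types tsb)//.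
apply: contra b0 => /eqP ts0; rewrite -mi_deg_eq0 -size_sorted_types -tsb.
by rewrite ts0.
Qed.

End TreeSums.

(** * Unrolling the linear part, and uniform bounds for a seminorm *)

Lemma big_mis_split (n d : nat) (V : nmodType) (f : mi n -> V) :
  \sum_(b <- mis d.+1 | b != mi0 n) f b =
  \sum_(j < n) f (mi_e j) + \sum_(b <- mis d.+1 | (1 < mi_deg b)%N) f b.
Proof.
rewrite (bigID (fun b => mi_deg b == 1%N)) /=; congr (_ + _); last first.
  by apply: eq_bigl => b; rewrite -mi_deg_eq0; case: (mi_deg b) => [|[]].
rewrite -big_filter -[RHS](big_map (@mi_e n) xpredT f).
apply: perm_big; apply: uniq_perm.
- by rewrite filter_uniq// mis_uniq.
- by rewrite map_inj_uniq ?index_enum_uniq//; exact: mi_e_inj.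
move=> b; rewrite mem_filter mem_mis -mi_deg_eq0.
apply/andP/mapP => [[/andP[_ /eqP/mi_deg_eq1[j ->]] _]|[j _ ->]].
  by exists j; rewrite ?mem_index_enum.
by rewrite mi_deg_e.
Qed.

Lemma exprS_mxE (R : pzRingType) (n : nat) (A : 'M[R]_n) l i j :
  (A ^+ l.+1) i j = \sum_k A i k * (A ^+ l) k j.
Proof. by rewrite exprS mxE. Qed.

(** Discrete variation of constants. The initial term is kept because the injectivity of F applies
    this to a constant sequence, which need not start at 0. *)
Lemma affine_rec_unroll (K : comPzRingType) (V : comAlgType K) (n : nat)
    (A : 'M[K]_n) (u : V) (v e : nat -> 'I_n -> V) :
  (forall d i, v d.+1 i = u * (e d i + \sum_j A i j *: v d j)) ->
  forall d i, v d i =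
    \sum_(l < d) u ^+ l.+1 * \sum_j (A ^+ l) i j *: e (d - l.+1)%N j +
    u ^+ d * \sum_j (A ^+ d) i j *: v 0%N j.
Proof.
move=> vS; elim=> [|d IH] i.
  rewrite big_ord0 add0r !expr0 mul1r (bigD1 i)//= mxE eqxx scale1r big1 ?addr0//.
  by move=> j; rewrite eq_sym mxE => /negbTE ->; rewrite scale0r.
have AS m l (w : 'I_n -> V) : \sum_j A i j *: (u ^+ m * \sum_k (A ^+ l) j k *: w k) =
    u ^+ m * \sum_k (A ^+ l.+1) i k *: w k.
  under eq_bigr => j _ do rewrite scalerAr scaler_sumr mulr_sumr.
  rewrite exchange_big /= mulr_sumr; apply: eq_bigr => k _.
  rewrite exprS_mxE scaler_suml mulr_sumr; apply: eq_bigr => j _.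
  by rewrite scalerA.
rewrite vS mulrDr big_ord_recl /= -addrA; congr (_ + _).
  rewrite expr1 (bigD1 i)//= mxE eqxx scale1r subSS subn0 big1 ?addr0//.
  by move=> j; rewrite eq_sym mxE => /negbTE ->; rewrite scale0r.
under eq_bigr => j _ do rewrite IH scalerDr.
rewrite big_split /= AS mulrDr mulrA -exprS; congr (_ + _).
under eq_bigr => j _ do rewrite scaler_sumr.
rewrite exchange_big /= mulr_sumr; apply: eq_bigr => l _.
by rewrite AS mulrA -exprS /bump /= add1n subSS.
Qed.

Section SeminormBound.
Context {R : realType} {n : nat} (h : 'I_n -> mi n -> R[i]).
Context {V : comAlgType R[i]} (nu : V -> R).
Hypothesis nu_ge0 : forall v, 0 <= nu v.
Hypothesis nu0 : nu 0 = 0.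
Hypothesis nu1 : nu 1 <= 1.
Hypothesis nuD : forall v w, nu (v + w) <= nu v + nu w.
Hypothesis nuM : forall v w, nu (v * w) <= nu v * nu w.
Hypothesis nuZ : forall c v, nu (c *: v) <= cn c * nu v.
Context {u : V} {u0 beta : R}.
Hypothesis nu_u : nu u <= u0.
Hypothesis beta_ge : forall i d,
  \sum_(l < d) u0 ^+ l.+1 * \sum_j cn ((Amat h ^+ l) i j) <= beta.

Lemma nu_sum (I : Type) (s : seq I) (P : pred I) (F : I -> V) :
  nu (\sum_(k <- s | P k) F k) <= \sum_(k <- s | P k) nu (F k).
Proof.
elim/big_rec2: _ => [|k b a _ ab]; first by rewrite nu0.
by rewrite (le_trans (nuD _ _))// lerD2l.
Qed.

Lemma nu_exp v b k : nu v <= b -> nu (v ^+ k) <= b ^+ k.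
Proof.
move=> vb; elim: k => [|k IH]; first by rewrite !expr0.
by rewrite !exprS (le_trans (nuM _ _))// ler_pM.
Qed.

Lemma nu_monomial (v : 'I_n -> V) M (b : mi n) : (forall j, nu (v j) <= M) ->
  nu (\prod_j v j ^+ b j) <= M ^+ mi_deg b.
Proof.
move=> vM; rewrite -prod_sorted_types -size_sorted_types.
elim: (sorted_types b) => [|j s IH]; first by rewrite big_nil expr0.
by rewrite big_cons exprS (le_trans (nuM _ _))// ler_pM.
Qed.

(** After unrolling, [A] occurs only through its powers, whose weighted sum is at most [beta]. *)
Lemma affine_rec_bound (v e : nat -> 'I_n -> V) (E : R) : 0 <= E ->
  (forall i, v 0%N i = 0) ->
  (forall d i, v d.+1 i = u * (e d i + \sum_j Amat h i j *: v d j)) ->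
  forall d, (forall k j, (k < d)%N -> nu (e k j) <= E) ->
  forall i, nu (v d i) <= beta * E.
Proof.
move=> E0 v0 vS d eE i; have u0_ge0 : 0 <= u0 := le_trans (nu_ge0 u) nu_u.
rewrite (affine_rec_unroll vS) [X in _ + _ * X]big1 ?mulr0 ?addr0; last first.
  by move=> j _; rewrite v0 scaler0.
apply: le_trans (ler_wpM2r E0 (beta_ge i d)); rewrite mulr_suml.
apply: le_trans (nu_sum _ _ _) _; apply: ler_sum => l _.
rewrite (le_trans (nuM _ _))// -mulrA ler_pM ?nu_exp// mulr_suml.
apply: le_trans (nu_sum _ _ _) _; apply: ler_sum => j _.
rewrite (le_trans (nuZ _ _))// ler_wpM2l ?cn_ge0// eE//.
by rewrite ltn_subrL /=; case: (d) l => // -[].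
Qed.

Lemma prod_mi_e (v : 'I_n -> V) j : \prod_k v k ^+ mi_e j k = v j.
Proof.
rewrite (bigD1 j)//= ffunE eqxx expr1 big1 ?mulr1// => k kj.
by rewrite ffunE (negbTE kj).
Qed.

(** A bootstrap: if all earlier rounds are bounded by [M], the inhomogeneous terms are at most y +
    q, and [beta * (y + q) <= M] closes the loop. The unrolled sum involves every earlier round,
    hence the strong induction. *)
Lemma tree_sum_bound (x : 'I_n -> V) (y q M : R) :
  0 <= y -> (forall j, nu (x j) <= y) -> 0 <= q ->
  (forall i d, \sum_(b <- mis d | (1 < mi_deg b)%N) cn (h i b) * M ^+ mi_deg b <= q) ->
  beta * (y + q) <= M ->
  forall d i, nu (tree_sum h u x d i) <= M.
Proof.
move=> y0 xy q0 hq bM; elim/ltn_ind => d IH i; apply: le_trans bM.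
pose e k j := x j + \sum_(b <- mis k.+1 | (1 < mi_deg b)%N)
                      h j b *: \prod_l tree_sum h u x k l ^+ b l.
apply: (affine_rec_bound (v := tree_sum h u x) (e := e)); first exact: addr_ge0.
- by move=> j; rewrite /tree_sum big_nil.
- move=> k j; rewrite tree_sumS big_mis_split -addrA; congr (_ * (_ + _)).
  rewrite addrC; congr (_ + _); apply: eq_bigr => l _.
  by rewrite prod_mi_e mxE.
move=> k j kd; rewrite (le_trans (nuD _ _))// lerD// (le_trans _ (hq j k.+1))//.
apply: le_trans (nu_sum _ _ _) _; apply: ler_sum => b _.
rewrite (le_trans (nuZ _ _))// ler_wpM2l ?cn_ge0//.
by apply: nu_monomial => l; exact: IH.
Qed.

End SeminormBound.

(** * The weighted l^1 norm on polynomials *)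

Section WeightedL1Norm.
Context {R : realType} {m : nat} (w : 'I_m -> R).
Hypothesis w_ge0 : forall i, 0 <= w i.
Implicit Types (p q : mpoly.mpoly m R[i]) (k : mpoly.multinom m).

Definition mnm_weight k : R := \prod_i w i ^+ k i.

Definition l1norm p : R :=
  \sum_(k <- mpoly.msupp p) cn (mpoly.mcoeff k p) * mnm_weight k.

Lemma mnm_weight_ge0 k : 0 <= mnm_weight k.
Proof. by apply: prodr_ge0 => i _; rewrite exprn_ge0. Qed.

Lemma mnm_weightD k l :
  mnm_weight (mpoly.mnm_add k l) = mnm_weight k * mnm_weight l.
Proof.
by rewrite -big_split /=; apply: eq_bigr => i _; rewrite mpoly.mnmDE exprD.
Qed.

Lemma l1norm_le p (s : seq (mpoly.multinom m)) : uniq s ->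
  \sum_(k <- s) cn (mpoly.mcoeff k p) * mnm_weight k <= l1norm p.
Proof.
move=> su; rewrite (bigID (mem (mpoly.msupp p))) /= [X in _ + X]big1 ?addr0; last first.
  by move=> k; rewrite -mpoly.mcoeff_eq0 => /eqP ->; rewrite cn0 mul0r.
rewrite -big_filter /l1norm [leRHS](bigID (mem s)) /=.
rewrite -[X in _ <= X + _]big_filter.
rewrite (perm_big [seq k <- mpoly.msupp p | k \in s]).
  by rewrite lerDl sumr_ge0// => k _; rewrite mulr_ge0 ?cn_ge0 ?mnm_weight_ge0.
apply: uniq_perm => [||k]; rewrite ?filter_uniq// ?mpoly.msupp_uniq//.
by rewrite !mem_filter andbC.
Qed.

Lemma l1norm_sub p (s : seq (mpoly.multinom m)) : uniq s ->
  {subset mpoly.msupp p <= s} ->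
  l1norm p = \sum_(k <- s) cn (mpoly.mcoeff k p) * mnm_weight k.
Proof.
move=> su ps; apply/eqP; rewrite eq_le l1norm_le// andbT.
rewrite [leRHS](bigID (mem (mpoly.msupp p))) /= -[X in _ <= X + _]big_filter.
rewrite (perm_big (mpoly.msupp p)).
  by rewrite lerDl sumr_ge0// => k _; rewrite mulr_ge0 ?cn_ge0 ?mnm_weight_ge0.
apply: uniq_perm => [||k]; rewrite ?filter_uniq// ?mpoly.msupp_uniq//.
by rewrite !mem_filter; apply: andb_idr => /ps.
Qed.

Lemma l1norm_ge0 p : 0 <= l1norm p.
Proof. by apply: sumr_ge0 => k _; rewrite mulr_ge0 ?cn_ge0 ?mnm_weight_ge0. Qed.

Lemma l1norm0 : l1norm 0 = 0.
Proof. by rewrite /l1norm mpoly.msupp0 big_nil. Qed.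

Lemma l1normD p q : l1norm (p + q) <= l1norm p + l1norm q.
Proof.
pose s := undup (mpoly.msupp p ++ mpoly.msupp q).
have su : uniq s by exact: undup_uniq.
rewrite (l1norm_sub (p := p + q) su) => [|k /mpoly.msuppD_le]; last by rewrite mem_undup.
rewrite (l1norm_sub (p := p) su) => [|k kp]; last by rewrite mem_undup mem_cat kp.
rewrite (l1norm_sub (p := q) su) => [|k kq]; last by rewrite mem_undup mem_cat kq orbT.
rewrite -big_split /=; apply: ler_sum => k _.
by rewrite mpoly.mcoeffD -mulrDl ler_wpM2r ?mnm_weight_ge0 ?cnD.
Qed.

Lemma l1normZ c p : l1norm (c *: p) <= cn c * l1norm p.
Proof.
have su : uniq (mpoly.msupp p) by exact: mpoly.msupp_uniq.
rewrite (l1norm_sub (p := c *: p) su) => [|k /mpoly.msuppZ_le//].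
rewrite /l1norm mulr_sumr; apply: ler_sum => k _.
by rewrite mpoly.mcoeffZ cnM mulrA.
Qed.

Lemma l1normX k : l1norm (mpoly.mpolyX R[i] k) = mnm_weight k.
Proof. by rewrite /l1norm mpoly.msuppX big_seq1 mpoly.mcoeffX eqxx cn1 mul1r. Qed.

Lemma l1norm1 : l1norm 1 = 1.
Proof.
rewrite -mpoly.mpolyX0 l1normX /mnm_weight big1// => i _.
by rewrite mpoly.mnm0E expr0.
Qed.

Lemma l1norm_sum (I : Type) (s : seq I) (F : I -> mpoly.mpoly m R[i]) :
  l1norm (\sum_(k <- s) F k) <= \sum_(k <- s) l1norm (F k).
Proof.
elim/big_rec2: _ => [|k b a _ ab]; first by rewrite l1norm0.
by rewrite (le_trans (l1normD _ _))// lerD2l.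
Qed.

(** The weights are multiplicative, so the triangle inequality on the expanded product suffices. *)
Lemma l1normM p q : l1norm (p * q) <= l1norm p * l1norm q.
Proof.
rewrite mpoly.mpolyME (le_trans (l1norm_sum _ _))// big_allpairs_dep /=.
rewrite /l1norm mulr_suml; apply: ler_sum => k _; rewrite mulr_sumr.
apply: ler_sum => l _; rewrite (le_trans (l1normZ _ _))// l1normX mnm_weightD.
by rewrite cnM mulrACA.
Qed.

End WeightedL1Norm.

(** * Tree polynomials, and their distance to the partial sums [gpart] *)

Section TreePolynomials.
Context {R : realType} {n : nat} (h : 'I_n -> mi n -> R[i]).
Implicit Types (t : ntree n) (i j : 'I_n) (a : mi n).

(* The variable [ord0] marks the vertices of a tree, [lift ord0 j] its leaves of
   type [j]. *)
Definition vert_leaf_mnm (k : nat) a : mpoly.multinom n.+1 :=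
  mpoly.Multinom [tuple oapp a k (unlift ord0 i) | i < n.+1].

Lemma vert_leaf_mnm0 k a : vert_leaf_mnm k a ord0 = k.
Proof. by rewrite mpoly.mnmE unlift_none. Qed.

Lemma vert_leaf_mnmS k a j : vert_leaf_mnm k a (lift ord0 j) = a j.
Proof. by rewrite mpoly.mnmE liftK. Qed.

Lemma vert_leaf_mnm_eq k a l b :
  (vert_leaf_mnm k a == vert_leaf_mnm l b) = (k == l) && (a == b).
Proof.
apply/eqP/andP => [kalb|[/eqP -> /eqP ->]//]; split; apply/eqP.
  by rewrite -(vert_leaf_mnm0 k a) kalb vert_leaf_mnm0.
by apply/ffunP => j; rewrite -(vert_leaf_mnmS k a) kalb vert_leaf_mnmS.
Qed.

Definition poly_var (i : 'I_n.+1) : mpoly.mpoly n.+1 R[i] :=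
  mpoly.mpolyX R[i] (mpoly.mnm1 i).

Definition tree_poly (d : nat) i : mpoly.mpoly n.+1 R[i] :=
  tree_sum h (poly_var ord0) (fun j => poly_var (lift ord0 j)) d i.

Lemma mcoeff_tree_poly d i k a :
  mpoly.mcoeff (vert_leaf_mnm k a) (tree_poly d i) =
  \sum_(t <- otrees d i | (nverts t == k) && (leaftype t == a)) tweight h t.
Proof.
rewrite /tree_poly /tree_sum raddf_sum [RHS]big_mkcond; apply: eq_bigr => t _.
rewrite /tree_term /= mpoly.mcoeffZ.
have -> : poly_var ord0 ^+ nverts t *
    \prod_(j < n) poly_var (lift ord0 j) ^+ nleaves j t =
    mpoly.mpolyX R[i] (vert_leaf_mnm (nverts t) (leaftype t)).
  rewrite [RHS]mpoly.mpolyXE_id big_ord_recl vert_leaf_mnm0; congr (_ * _).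
  by apply: eq_bigr => j _; rewrite vert_leaf_mnmS ffunE.
rewrite mpoly.mcoeffX vert_leaf_mnm_eq.
by case: ifP => _; rewrite ?mulr1 ?mulr0.
Qed.

End TreePolynomials.

Section PartialTreeSums.
Context {R : realType} {n : nat} (h : 'I_n -> mi n -> R[i]).
Implicit Types (t : ntree n) (i j : 'I_n) (a : mi n).

Lemma gpart_otrees d i a N : (N <= d)%N ->
  gpart h i a N =
  \sum_(t <- otrees d i | (leaftype t == a) && (nverts t <= N)%N) tweight h t.
Proof.
move=> Nd; rewrite -big_filter fsbig_seq ?filter_uniq ?otrees_uniq//.
rewrite /gpart; apply: eq_fsbigl; apply/seteqP; split=> t /=.
  move=> [[ot [<- <-]] tN]; rewrite mem_filter eqxx tN mem_otrees//.
  exact: leq_trans tN Nd.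
rewrite mem_filter => /andP[/andP[/eqP ta tN] td].
by split=> //; split; [exact: otrees_ordered td|split=> //; exact: otrees_type td].
Qed.

(** The coefficient of X^a in the tree polynomial after setting u = 1. *)
Definition leaf_coef d i a : R[i] :=
  \sum_(t <- otrees d i | leaftype t == a) tweight h t.

(** Trees with at most [N] vertices all lie in [otrees d] already, so they cancel and only powers of
    u above [N] remain. *)
Lemma leaf_coef_tail d i a N : (N <= d)%N -> exists K : nat,
  forall K', (K <= K')%N -> leaf_coef d i a - gpart h i a N =
  \sum_(k <- index_iota N.+1 K') mpoly.mcoeff (vert_leaf_mnm k a) (tree_poly h d i).
Proof.
(* A strict upper bound for the vertex count of every tree in the list. *)
move=> Nd; exists (\sum_(t <- otrees d i) nverts t).+1 => K KK.
rewrite (gpart_otrees _ _ Nd) /leaf_coef (bigID (fun t => (nverts t <= N)%N)) /=.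
rewrite addrAC subrr add0r.
under [RHS]eq_bigr => k _ do rewrite mcoeff_tree_poly.
rewrite (exchange_big_dep (fun t => leaftype t == a)) /=; last first.
  by move=> k t _ /andP[].
rewrite big_mkcondr /= big_seq_cond [RHS]big_seq_cond; apply: eq_bigr => t /andP[td ta].
case: leqP => [tN|Nt] /=.
  rewrite big_seq_cond big1// => k; rewrite mem_index_iota ta andbT.
  by move=> /andP[/andP[Nk _] /eqP tk]; rewrite -tk ltnNge tN in Nk.
rewrite -big_filter (perm_big [:: nverts t]) ?big_seq1//.
apply: uniq_perm; rewrite ?filter_uniq ?iota_uniq// => k.
rewrite mem_filter mem_index_iota inE ta andbT; apply/andP/eqP => [[/eqP->//]|->].
rewrite eqxx Nt; split=> //=; apply: leq_trans KK; rewrite ltnS.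
by rewrite (perm_big _ (perm_to_rem td)) big_cons leq_addr.
Qed.

Definition vert_leaf_weight (u0 y : R) (i : 'I_n.+1) : R :=
  oapp (fun=> y) u0 (unlift ord0 i).

Lemma mnm_weight_vert_leaf (u0 y : R) k a :
  mnm_weight (vert_leaf_weight u0 y) (vert_leaf_mnm k a) = u0 ^+ k * y ^+ mi_deg a.
Proof.
rewrite /mnm_weight big_ord_recl vert_leaf_mnm0 /vert_leaf_weight unlift_none /=.
congr (_ * _); rewrite /mi_deg expr_sum; apply: eq_bigr => j _.
by rewrite liftK vert_leaf_mnmS.
Qed.

(** A Chebyshev-type estimate: each monomial left in the difference carries a power of u above [N],
    hence a weight at least u0^N times that of its leaf part. *)
Lemma leaf_coef_dist (u0 y M : R) d i N (s : seq (mi n)) :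
  1 <= u0 -> 0 <= y -> (N <= d)%N -> uniq s ->
  l1norm (vert_leaf_weight u0 y) (tree_poly h d i) <= M ->
  \sum_(a <- s) cn (leaf_coef d i a - gpart h i a N) * y ^+ mi_deg a <= M / u0 ^+ N.
Proof.
move=> u1 y0 Nd su hM; have u0_gt0 : 0 < u0 by exact: lt_le_trans u1.
rewrite ler_pdivlMr ?exprn_gt0//; apply: le_trans hM.
(* One cutoff [K] for the whole finite list [s]. *)
have [K /(_ _ (leqnn K)) HK] : exists K : nat, forall K', (K <= K')%N ->
    forall a, a \in s -> leaf_coef d i a - gpart h i a N =
    \sum_(k <- index_iota N.+1 K') mpoly.mcoeff (vert_leaf_mnm k a) (tree_poly h d i).
  elim: (s) => [|a s' [K HK]]; first by exists 0%N.
  have [K' HK'] := leaf_coef_tail i a Nd.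
  exists (maxn K K') => L; rewrite geq_max => /andP[KL K'L] b.
  by rewrite inE => /predU1P[->|]; [exact: HK'|exact: HK].
have wge0 k : 0 <= vert_leaf_weight u0 y k.
  by rewrite /vert_leaf_weight; case: unlift => //=; exact: ltW.
pose ks := [seq vert_leaf_mnm k a | a <- s, k <- index_iota N.+1 K].
apply: le_trans (l1norm_le wge0 (tree_poly h d i) (s := ks) _); last first.
  apply: allpairs_uniq => [//||]; first exact: iota_uniq.
  move=> [a k] [b l] _ _ /= /eqP; rewrite vert_leaf_mnm_eq.
  by move=> /andP[/eqP -> /eqP ->].
rewrite big_allpairs_dep mulr_suml /= big_seq [leRHS]big_seq; apply: ler_sum => a /HK ->.
rewrite -mulrA mulrC; apply: le_trans (ler_wpM2l _ (cn_sum _ _ _)) _.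
  by rewrite mulr_ge0 ?exprn_ge0// ltW.
rewrite mulr_sumr big_seq [leRHS]big_seq; apply: ler_sum => k.
rewrite mem_index_iota => /andP[Nk _]; rewrite mnm_weight_vert_leaf mulrC.
rewrite ler_wpM2l ?cn_ge0// mulrC ler_wpM2r ?exprn_ge0//.
by rewrite ler_weXn2l// ltnW.
Qed.

End PartialTreeSums.

(** * Geometric decay from the convergence of the Neumann series *)

Section NeumannSeries.
Context {R : realType} {n : nat}.
Implicit Types (A B C : 'M[R[i]]_n) (i j : 'I_n).

Definition mxnorm1 A : R := \sum_i \sum_j cn (A i j).

Lemma mxnorm1_ge0 A : 0 <= mxnorm1 A.
Proof. by apply: sumr_ge0 => i _; apply: sumr_ge0 => j _; exact: cn_ge0. Qed.

Lemma mxnorm1_row A i : \sum_j cn (A i j) <= mxnorm1 A.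
Proof.
rewrite /mxnorm1 [leRHS](bigD1 i)//= lerDl.
by apply: sumr_ge0 => k _; apply: sumr_ge0 => j _; exact: cn_ge0.
Qed.

Lemma mxnorm1M A B : mxnorm1 (A *m B) <= mxnorm1 A * mxnorm1 B.
Proof.
rewrite {1 2}/mxnorm1 mulr_suml; apply: ler_sum => i _; rewrite mulr_suml.
apply: (@le_trans _ _ (\sum_j \sum_k cn (A i k) * cn (B k j))).
  apply: ler_sum => j _; rewrite mxE (le_trans (cn_sum _ _ _))//.
  by apply: ler_sum => k _; rewrite cnM.
rewrite exchange_big /=; apply: ler_sum => k _.
by rewrite -mulr_sumr ler_wpM2l ?cn_ge0 ?mxnorm1_row.
Qed.

Lemma neumann_terms_cvg0 A :
  (forall i j, cvg ((fun N : nat => (\sum_(k < N) A ^+ k) i j) @ \oo)) ->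
  (* There are n * n entries; the successor in the denominator below covers n = 0. *)
  forall e : R, 0 < e -> exists N, forall k, (N <= k)%N -> mxnorm1 (A ^+ k) <= e.
Proof.
move=> Acv e e0; pose e' := e / (n * n).+1%:R.
have e'0 : 0 < e' by rewrite divr_gt0.
have e'2 : 0 < e' / 2 by rewrite divr_gt0.
have /choice[f Hf] : forall ij : 'I_n * 'I_n, exists N, forall k, (N <= k)%N ->
    cn ((A ^+ k) ij.1 ij.2) <= e'.
  move=> [i j] /=; have /cvg_ex[/= l /cvgCP/(_ _ e'2)[N HN]] := Acv i j.
  exists N => k Nk; have H1 := HN _ Nk; have H2 := HN _ (leqW Nk).
  have -> : (A ^+ k) i j = (\sum_(k < k.+1) A ^+ k) i j - (\sum_(k < k) A ^+ k) i j.
    rewrite big_ord_recr mxE /=.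
    by rewrite addrAC subrr add0r.
  apply: le_trans (cn_distD l _ _) _; rewrite (cn_distC l); lra.
exists (\max_ij f ij)%N => k Nk; rewrite /mxnorm1.
apply: (@le_trans _ _ (\sum_(i < n) \sum_(j < n) e')).
  apply: ler_sum => i _; apply: ler_sum => j _; apply: (Hf (i, j)).
  exact: leq_trans (leq_bigmax _) Nk.
rewrite !sumr_const !card_ord -mulrnA -mulr_natr /e' mulrAC ler_pdivrMr//.
by rewrite ler_pM2l// ler_nat.
Qed.

(** Convexity: the right side is the chord over [0, 1]. At t = 2^-k it is below 2, which gives
    [u0 ^+ K <= 2] later. *)
Lemma expr1D_le (t : R) k : 0 <= t <= 1 -> (1 + t) ^+ k <= 1 + (2 ^+ k - 1) * t.
Proof.
move=> /andP[t0 t1]; elim: k => [|k IH]; first by rewrite !expr0 subrr mul0r addr0.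
have p1 : 1 <= 2 ^+ k :> R by rewrite exprn_ege1// ler1n.
have q1 : 0 <= (2 ^+ k - 1) * (t * (1 - t)) by rewrite !mulr_ge0// subr_ge0.
rewrite !exprS; apply: le_trans (ler_wpM2l _ IH) _; first lra.
by move: q1; move: (2 ^+ k) => p; lra.
Qed.

(* Once [|A^K| <= 1/4], any [u0 > 1] with [u0^K <= 2] makes [u0^l |A^l|] halve
   each time [l] grows by [K]. *)
Lemma neumann_geometric A :
  (forall i j, cvg ((fun N : nat => (\sum_(k < N) A ^+ k) i j) @ \oo)) ->
  exists u0 beta : R, [/\ 1 < u0, 0 < beta & forall i d,
    \sum_(l < d) u0 ^+ l.+1 * \sum_j cn ((A ^+ l) i j) <= beta].
Proof.
move=> /neumann_terms_cvg0 A0.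
have [K /(_ _ (leqnn K)) HK] := A0 (1 / 4) (divr_gt0 ltr01 (ltr0n _ 4)).
have p0 : 0 < 2 ^+ K :> R by rewrite exprn_gt0.
pose u0 : R := 1 + (2 ^+ K)^-1.
have t0 : 0 < (2 ^+ K)^-1 :> R by rewrite invr_gt0.
have t1 : (2 ^+ K)^-1 <= 1 :> R by rewrite invf_le1// exprn_ege1// ler1n.
have u1 : 1 < u0 by rewrite ltrDl.
have u00 : 0 <= u0 by lra.
have uK : u0 ^+ K <= 2.
  apply: le_trans (expr1D_le K _) _; first by rewrite t1 ltW.
  rewrite mulrBl divff ?gt_eqF// mul1r.
  by move: t0; move: (_^-1) => t t0; lra.
pose f l := u0 ^+ l * mxnorm1 (A ^+ l).
have f0 l : 0 <= f l by rewrite mulr_ge0 ?exprn_ge0 ?mxnorm1_ge0.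
have fK l : f (K + l)%N <= f l / 2.
  have ul : 0 <= u0 ^+ l by rewrite exprn_ge0.
  have uK0 : 0 <= u0 ^+ K by rewrite exprn_ge0.
  have h1 : u0 ^+ K * mxnorm1 (A ^+ K) <= 2 * (1 / 4).
    by rewrite ler_pM ?mxnorm1_ge0.
  rewrite /f !exprD.
  apply: le_trans (ler_wpM2l (mulr_ge0 uK0 ul) (mxnorm1M _ _)) _.
  rewrite mulrACA [leRHS]mulrC.
  by apply: le_trans (ler_wpM2r (f0 l) h1) _; rewrite ler_wpM2r//; lra.
pose S d := \sum_(l < d) f l.
(* Shifting the index by [K] gives S d <= S K + S d / 2, so no geometric series has to be summed. *)
have SK d : S d <= 2 * S K.
  have h1 : S d <= S (K + d)%N.
    rewrite /S -!(big_mkord xpredT f) [leRHS](@big_cat_nat _ _ _ d)//= ?leq_addl// lerDl.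
    exact: sumr_ge0.
  have h2 : S (K + d)%N <= S K + S d / 2.
    rewrite /S big_split_ord /= lerD2l mulr_suml; apply: ler_sum => l _.
    exact: fK.
  lra.
have SK0 : 0 <= S K by exact: sumr_ge0.
(* The added 1 keeps [beta] positive when [S K] vanishes, as for n = 0. *)
exists u0, (u0 * (2 * S K) + 1); split=> // [|i d]; first by rewrite ltr_wpDl// !mulr_ge0.
apply: (@le_trans _ _ (u0 * S d)); last first.
  have := ler_wpM2l u00 (SK d); lra.
rewrite mulr_sumr; apply: ler_sum => l _; rewrite exprS -mulrA.
by rewrite !ler_wpM2l ?exprn_ge0// mxnorm1_row.
Qed.

End NeumannSeries.

(** * Values of power series and Lipschitz bounds for monomials *)

Section PowerSeries.
Context {R : realType} {n : nat}.
Implicit Types (c : mi n -> R[i]) (x y : 'I_n -> R[i]) (a b : mi n).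

Lemma psumE c x N : psum c x N = \sum_(a <- mis N) c a * mono x a.
Proof.
rewrite fsbig_seq ?mis_uniq//; apply: eq_fsbigl.
by apply/seteqP; split=> a /=; rewrite mem_mis.
Qed.

Lemma big_mis_le (V : nmodType) (F : mi n -> V) N N' : (N <= N')%N ->
  \sum_(a <- mis N' | (mi_deg a <= N)%N) F a = \sum_(a <- mis N) F a.
Proof.
move=> NN'; rewrite -big_filter; apply: perm_big.
apply: uniq_perm; [by rewrite filter_uniq ?mis_uniq|exact: mis_uniq|move=> a].
by rewrite mem_filter !mem_mis; apply: andb_idr => /leq_trans; exact.
Qed.

Lemma big_mis_sub (V : zmodType) (F : mi n -> V) N N' : (N <= N')%N ->
  \sum_(a <- mis N') F a - \sum_(a <- mis N) F a =
  \sum_(a <- mis N' | (N < mi_deg a)%N) F a.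
Proof.
move=> NN'; rewrite (bigID (fun a => mi_deg a <= N)%N) /= big_mis_le//.
by rewrite addrAC subrr add0r; apply: eq_bigl => a; rewrite ltnNge.
Qed.

Lemma abs_summableP (v : mi n -> R[i]) : abs_summable v <->
  exists M : R, forall s, uniq s -> \sum_(a <- s) cn (v a) <= M.
Proof.
have sumE s : \sum_(a <- s) `|v a| = (\sum_(a <- s) cn (v a))%:C%C.
  by rewrite raddf_sum; apply: eq_bigr => a _; rewrite normCE.
by split=> -[M HM]; exists M => s /HM; rewrite sumE lecR2.
Qed.

Lemma ps_conv_cvg c x : ps_conv c x -> psum c x @ \oo --> ps_val c x.
Proof.
move=> /abs_summableP[M HM].
pose S N : R := \sum_(a <- mis N) cn (c a * mono x a).
have Snd : nondecreasing_seq S.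
  apply/nondecreasing_seqP => N; rewrite -subr_ge0 big_mis_sub ?leqnSn//.
  by apply: sumr_ge0 => a _; exact: cn_ge0.
have /cvg_ex[l /cvgRP Sl] : cvg (S @ \oo).
  apply: nondecreasing_is_cvgn => //; exists M => _ [N _ <-].
  by apply: HM; exact: mis_uniq.
have [L HL] : exists L : R[i], psum c x @ \oo --> L.
  apply: cauchyC => e e0; have [N HN] := Sl _ (divr_gt0 e0 (ltr0n _ 2)).
  have {}HN k k' : (N <= k)%N -> (k <= k')%N -> cn (psum c x k' - psum c x k) <= e.
    move=> Nk kk'; have H1 := HN _ Nk; have H2 := HN _ (leq_trans Nk kk').
    rewrite !psumE big_mis_sub//; apply: le_trans (cn_sum _ _ _) _.
    rewrite -big_mis_sub// -/(S k) -/(S k'); apply: le_trans (ler_norm _) _.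
    by apply: le_trans (ler_distD l _ _) _; rewrite (distrC l); lra.
  exists N => k k' Nk Nk'; case: (leqP k k') => [|/ltnW] kk'; last exact: HN.
  by rewrite cn_distC; exact: HN.
by have := HL; rewrite -(cvgC_lim HL).
Qed.

Lemma psum_nz c x N :
  psum (nz c) x N = \sum_(a <- mis N | a != mi0 n) c a * mono x a.
Proof.
rewrite psumE [RHS]big_mkcond; apply: eq_bigr => a _; rewrite /nz.
by case: eqVneq; rewrite ?mul0r.
Qed.

Lemma mono_mi_e x j : mono x (mi_e j) = x j.
Proof.
rewrite /mono (bigD1 j)//= ffunE eqxx expr1 big1 ?mulr1// => k kj.
by rewrite ffunE (negbTE kj).
Qed.

Lemma cn_mono_le x a (M : R) : (forall j, cn (x j) <= M) ->
  cn (mono x a) <= M ^+ mi_deg a.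
Proof.
move=> xM; rewrite /mono -prod_sorted_types -size_sorted_types.
elim: (sorted_types a) => [|j s IH]; first by rewrite big_nil expr0 cn1.
by rewrite big_cons exprS cnM ler_pM ?cn_ge0.
Qed.

(** Telescoping: the factors of the monomial, listed by [sorted_types], are exchanged one at a
    time. *)
Lemma mono_lipschitz x y a (M d : R) :
  (forall j, cn (x j) <= M) -> (forall j, cn (y j) <= M) ->
  (forall j, cn (x j - y j) <= d) ->
  cn (mono x a - mono y a) <= (mi_deg a)%:R * M ^+ (mi_deg a).-1 * d.
Proof.
move=> xM yM xyd; rewrite /mono -!prod_sorted_types -size_sorted_types.
have prodM z s : (forall j, cn (z j) <= M) ->
    cn (\prod_(j <- s) z j) <= M ^+ size s.
  move=> zM; elim: s => [|j s IH]; first by rewrite big_nil expr0 cn1.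
  by rewrite big_cons exprS cnM ler_pM ?cn_ge0.
elim: (sorted_types a) => [|j s IH]; first by rewrite !big_nil subrr cn0 !mul0r.
have M0 : 0 <= M := le_trans (cn_ge0 _) (xM j).
rewrite !big_cons /=.
have -> : x j * \prod_(k <- s) x k - y j * \prod_(k <- s) y k =
    (x j - y j) * \prod_(k <- s) x k +
    y j * (\prod_(k <- s) x k - \prod_(k <- s) y k) by ring.
apply: le_trans (cnD _ _) _; rewrite !cnM.
have H1 : cn (x j - y j) * cn (\prod_(k <- s) x k) <= M ^+ size s * d.
  by rewrite mulrC ler_pM ?cn_ge0 ?prodM.
have H2 : cn (y j) * cn (\prod_(k <- s) x k - \prod_(k <- s) y k) <=
    (size s)%:R * M ^+ size s * d.
  apply: le_trans (ler_pM (cn_ge0 _) (cn_ge0 _) (yM j) IH) _.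
  rewrite mulrA mulrCA.
  (* For empty [s] the predecessor in the exponent is truncated, but the factor [size s] is 0. *)
  by case: s {IH H1} => [|k s]; rewrite /= ?mul0r// exprS.
by rewrite -natr1 !mulrDl mul1r addrC lerD.
Qed.

End PowerSeries.

(** * Majorant estimates for F and its local injectivity *)

Section Majorant.
Context {R : realType} {n : nat} (h : 'I_n -> mi n -> R[i]) (rho H : R).
Hypothesis rho0 : 0 < rho.
Hypothesis H0 : 0 <= H.
Hypothesis hH : forall i s, uniq s ->
  \sum_(a <- s | a != mi0 n) cn (h i a) * rho ^+ mi_deg a <= H.
Implicit Types (x y : 'I_n -> R[i]) (a b : mi n).

Lemma majorant_sum i (s : seq (mi n)) (P : pred (mi n)) (w : mi n -> R) (K : R) :
  uniq s -> 0 <= K -> (forall a, P a -> a != mi0 n /\ w a <= K * rho ^+ mi_deg a) ->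
  \sum_(a <- s | P a) cn (h i a) * w a <= K * H.
Proof.
move=> su K0 wP; apply: le_trans (ler_wpM2l K0 (hH i su)); rewrite mulr_sumr.
rewrite big_mkcond [leRHS]big_mkcond /=; apply: ler_sum => a _.
case: ifP => [/wP[-> wa]|_]; first by rewrite mulrCA ler_wpM2l ?cn_ge0.
by case: ifP => // _; rewrite !mulr_ge0 ?cn_ge0 ?exprn_ge0// ltW.
Qed.

(* Because [k <= 4^(k-1)]. *)
Lemma deg_weight1 (M : R) k : 0 <= M -> M <= rho / 4 -> (0 < k)%N ->
  k%:R * M ^+ k.-1 <= rho^-1 * rho ^+ k.
Proof.
move=> M0 M4; case: k => // k _ /=; rewrite exprS mulKf ?gt_eqF//.
apply: (@le_trans _ _ (k.+1%:R * (rho / 4) ^+ k)).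
  by rewrite ler_wpM2l// lerXn2r// nnegrE divr_ge0// ltW.
rewrite exprMn mulrCA ler_piMr ?exprn_ge0 ?(ltW rho0)//.
rewrite exprVn ler_pdivrMr ?exprn_gt0// mul1r -natrX ler_nat.
by elim: k => // k IH; rewrite expnS; lia.
Qed.

(** Because k <= 2 * 4^(k-2) for k >= 2. The factor [M] gained over degree 1 makes the nonlinear
    part of F contract near 0. *)
Lemma deg_weight2 (M : R) k : 0 <= M -> M <= rho / 4 -> (1 < k)%N ->
  k%:R * M ^+ k.-1 <= (2 * M / rho ^+ 2) * rho ^+ k.
Proof.
move=> M0 M4; case: k => [|[|k]]// _ /=.
have -> : 2 * M / rho ^+ 2 * rho ^+ k.+2 = 2 * (M * rho ^+ k).
  by rewrite !exprS expr0; field; rewrite gt_eqF.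
apply: (@le_trans _ _ (k.+2%:R * (M * (rho / 4) ^+ k))).
  by rewrite exprS ler_wpM2l// ler_wpM2l// lerXn2r// nnegrE divr_ge0// ltW.
rewrite exprMn exprVn.
have -> : k.+2%:R * (M * (rho ^+ k / 4 ^+ k)) = k.+2%:R / 4 ^+ k * (M * rho ^+ k).
  by rewrite mulrA [in RHS]mulrAC -!mulrA.
rewrite ler_wpM2r ?mulr_ge0 ?exprn_ge0 ?(ltW rho0)//.
rewrite ler_pdivrMr ?exprn_gt0// -natrX -natrM ler_nat.
by elim: k => // k IH; rewrite expnS; lia.
Qed.

(** Shrinking the radius from [rho] to [M] gains (M / rho)^2 on every term of degree at least 2. *)
Lemma majorant_quadratic (M : R) i d : 0 <= M -> M <= rho ->
  \sum_(a <- mis d | (1 < mi_deg a)%N) cn (h i a) * M ^+ mi_deg a <=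
  M ^+ 2 / rho ^+ 2 * H.
Proof.
move=> M0 Mr; apply: majorant_sum; rewrite ?mis_uniq ?divr_ge0 ?exprn_ge0 ?(ltW rho0)//.
move=> a a1; split; first by rewrite -mi_deg_eq0; case: mi_deg a1.
case: (mi_deg a) a1 => [|[|k]]// _.
have -> : M ^+ 2 / rho ^+ 2 * rho ^+ k.+2 = M ^+ 2 * rho ^+ k.
  by rewrite !exprS expr0; field; rewrite gt_eqF.
by rewrite -addn2 exprD mulrC ler_wpM2l ?exprn_ge0// lerXn2r// nnegrE ltW.
Qed.

Section Difference.
Context {M d : R} {x y : 'I_n -> R[i]}.
Hypothesis M4 : M <= rho / 4.
Hypothesis xM : forall j, cn (x j) <= M.
Hypothesis yM : forall j, cn (y j) <= M.
Hypothesis xyd : forall j, cn (x j - y j) <= d.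
Hypothesis M0 : 0 <= M.
Hypothesis d0 : 0 <= d.

Lemma mono_diff_sum (P : pred (mi n)) (K : R) i N : 0 <= K ->
  (forall a, P a -> a != mi0 n /\
     (mi_deg a)%:R * M ^+ (mi_deg a).-1 <= K * rho ^+ mi_deg a) ->
  cn (\sum_(a <- mis N | P a) h i a * (mono x a - mono y a)) <= K * H * d.
Proof.
move=> K0 HP; apply: le_trans (cn_sum _ _ _) _.
apply: le_trans (ler_wpM2r d0 (majorant_sum i (mis_uniq N) K0 HP)).
rewrite mulr_suml; apply: ler_sum => a _; rewrite cnM -mulrA.
by rewrite ler_wpM2l ?cn_ge0 ?mono_lipschitz.
Qed.

Lemma psum_diff i N : psum (nz (h i)) x N - psum (nz (h i)) y N =
  \sum_(a <- mis N | a != mi0 n) h i a * (mono x a - mono y a).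
Proof.
by rewrite !psum_nz -sumrB; apply: eq_bigr => a _; rewrite mulrBr.
Qed.

Lemma psum_lipschitz i N :
  cn (psum (nz (h i)) x N - psum (nz (h i)) y N) <= rho^-1 * H * d.
Proof.
rewrite psum_diff; apply: mono_diff_sum; first by rewrite invr_ge0 ltW.
by move=> a a0; split=> //; apply: deg_weight1; rewrite ?lt0n ?mi_deg_eq0.
Qed.

Lemma psum_diff_linear i N :
  cn (psum (nz (h i)) x N.+1 - psum (nz (h i)) y N.+1 -
      \sum_j Amat h i j * (x j - y j)) <= 2 * M / rho ^+ 2 * H * d.
Proof.
rewrite psum_diff big_mis_split.
rewrite (eq_bigr (fun j => Amat h i j * (x j - y j))); last first.
  by move=> j _; rewrite mxE !mono_mi_e.
rewrite addrAC subrr add0r; apply: mono_diff_sum.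
  by rewrite divr_ge0 ?exprn_ge0 ?mulr_ge0 ?(ltW rho0).
move=> a a1; split; first by rewrite -mi_deg_eq0; case: mi_deg a1.
exact: deg_weight2.
Qed.

Hypothesis xcv : forall i, ps_conv (nz (h i)) x.
Hypothesis ycv : forall i, ps_conv (nz (h i)) y.

Lemma ps_val_diff_linear i :
  cn (ps_val (nz (h i)) x - ps_val (nz (h i)) y -
      \sum_j Amat h i j * (x j - y j)) <= 2 * M / rho ^+ 2 * H * d.
Proof.
apply: (cvgC_le (N := 1) (cvgC_sub (ps_conv_cvg (xcv i)) (ps_conv_cvg (ycv i)))).
by case=> // k _; exact: psum_diff_linear.
Qed.

End Difference.

(* With [F x = F y] the difference [v = x - y] satisfies [v = A v + e] with [e]
   of second order, hence [v = A^K v + \sum_(l < K) A^l e], which is small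
   compared to [v]. *)
Lemma Fmap_injective (M u0 beta : R) (x y : 'I_n -> R[i]) :
  (forall i j, cvg ((fun N : nat => (\sum_(k < N) Amat h ^+ k) i j) @ \oo)) ->
  1 <= u0 -> 0 <= beta ->
  (forall i d, \sum_(l < d) u0 ^+ l.+1 * \sum_j cn ((Amat h ^+ l) i j) <= beta) ->
  0 <= M -> M <= rho / 4 -> beta * (2 * M / rho ^+ 2 * H) <= 1 / 4 ->
  (forall j, cn (x j) <= M) -> (forall j, cn (y j) <= M) ->
  (forall i, ps_conv (nz (h i)) x) -> (forall i, ps_conv (nz (h i)) y) ->
  (forall i, Fmap h x i = Fmap h y i) -> forall i, x i = y i.
Proof.
move=> Acv u1 beta0 beta_ge M0 M4 Msmall xM yM xcv ycv Fxy.
pose d : R := \big[Num.max/0]_j cn (x j - y j).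
have d0 : 0 <= d by exact: bigmax_ge_id.
have xyd j : cn (x j - y j) <= d by exact: (le_bigmax_cond _ (fun j => cn (x j - y j))).
pose e (k : nat) i : (R[i])^o := ps_val (nz (h i)) x - ps_val (nz (h i)) y -
      \sum_j Amat h i j * (x j - y j).
have eE k i : cn (e k i) <= 2 * M / rho ^+ 2 * H * d.
  exact: ps_val_diff_linear.
(* The difference is a fixed point of the affine recursion with u = 1, so it is unrolled as a
   constant sequence. *)
have vS (k : nat) i : (x i - y i : (R[i])^o) =
    1 * (e k i + \sum_j Amat h i j *: (x j - y j : (R[i])^o)).
  rewrite mul1r /e subrK; have := Fxy i; rewrite /Fmap => Fi.
  by rewrite -[x i](subrK (ps_val (nz (h i)) x)) Fi; ring.
have [K /(_ _ (leqnn K)) HK] := neumann_terms_cvg0 Acv (divr_gt0 ltr01 (ltr0n R 4)).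
(* A quarter of [d] comes from the accumulated errors and a quarter from [A^K]; together they force
   d = 0. *)
have dhalf : d <= d / 2.
  apply: bigmax_le => [|i _]; first by rewrite divr_ge0.
  have -> := affine_rec_unroll (v := fun=> fun i => x i - y i : (R[i])^o) vS K i.
  apply: le_trans (cnD _ _) _.
  set E := 2 * M / rho ^+ 2 * H in Msmall eE.
  have E0 : 0 <= E by rewrite mulr_ge0// divr_ge0 ?exprn_ge0 ?mulr_ge0 ?(ltW rho0).
  have H1 : cn (\sum_(l < K) 1 ^+ l.+1 *
      \sum_j (Amat h ^+ l) i j * e (K - l.+1)%N j) <= beta * (E * d).
    apply: le_trans (ler_wpM2r (mulr_ge0 E0 d0) (beta_ge i K)).
    apply: le_trans (cn_sum _ _ _) _; rewrite mulr_suml; apply: ler_sum => l _.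
    rewrite expr1n mul1r -mulrA.
    have S0 : 0 <= (\sum_j cn ((Amat h ^+ l) i j)) * (E * d).
      by apply: mulr_ge0 (mulr_ge0 E0 d0); apply: sumr_ge0 => j _; exact: cn_ge0.
    (* The bound [beta] was obtained at [u0]; since u0 >= 1 it also covers u = 1. *)
    apply: le_trans (ler_peMl S0 (exprn_ege1 _ u1)).
    apply: le_trans (cn_sum _ _ _) _; rewrite mulr_suml; apply: ler_sum => j _.
    by rewrite cnM ler_wpM2l ?cn_ge0// eE.
  have H2 : cn (1 ^+ K * \sum_j (Amat h ^+ K) i j * (x j - y j)) <= 1 / 4 * d.
    rewrite expr1n mul1r; apply: le_trans (cn_sum _ _ _) _.
    apply: le_trans (ler_wpM2r d0 (le_trans (mxnorm1_row _ i) HK)).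
    rewrite mulr_suml; apply: ler_sum => j _.
    by rewrite cnM ler_wpM2l ?cn_ge0.
  have H3 := ler_wpM2r d0 Msmall.
  by apply: le_trans (lerD H1 H2) _; rewrite mulrA; lra.
move=> i; apply/eqP; rewrite -subr_eq0; apply/eqP/cn_eq0/eqP.
by rewrite eq_le cn_ge0 andbT; apply: le_trans (xyd i) _; lra.
Qed.

End Majorant.

(** * Convergence of the tree series, and F(G(x)) = x *)

Lemma geometric_small {R : realType} (u0 C : R) : 1 < u0 ->
  forall e : R, 0 < e -> exists N, forall k, (N <= k)%N -> C / u0 ^+ k <= e.
Proof.
move=> u1 e e0; have u00 : 0 < u0 by lra.
have /cvgRP/(_ _ e0)[N HN] : (fun k => C * u0^-1 ^+ k) @ \oo --> (0 : R).
  by apply: cvg_geometric; rewrite ger0_norm ?invr_ge0 ?(ltW u00)// invf_lt1.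
exists N => k /HN; rewrite subr0 exprVn; exact: le_trans (ler_norm _).
Qed.

(** At the point with all coordinates r / 2, absolute convergence is exactly a bound on the
    majorant; adding the bounds over i makes it uniform. *)
Lemma majorant_exists (R : realType) (n : nat) (h : 'I_n -> mi n -> R[i]) (r : R) :
  0 < r -> (forall x, polydisc r x -> forall i, ps_conv (nz (h i)) x) ->
  exists2 H : R, 0 <= H & forall i s, uniq s ->
    \sum_(a <- s | a != mi0 n) cn (h i a) * (r / 2) ^+ mi_deg a <= H.
Proof.
move=> r0 hcv; have r2 : 0 <= r / 2 by rewrite divr_ge0// ltW.
have /choice[B HB] : forall i, exists B : R, forall s, uniq s ->
    \sum_(a <- s) cn (nz (h i) a * mono (fun=> (r / 2)%:C%C) a) <= B.
  move=> i; apply/abs_summableP/hcv => j.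
  by rewrite lt_normC cn_real ger0_norm//; lra.
have B0 i : 0 <= B i by have := HB i [::] isT; rewrite big_nil.
exists (\sum_i B i); first exact: sumr_ge0.
move=> i s su; rewrite (bigD1 i)//=; apply: ler_wpDr; first exact: sumr_ge0.
apply: le_trans (HB i _ su); rewrite big_mkcond; apply: ler_sum => a _.
rewrite /nz; case: eqVneq => [_|a0] /=; first exact: cn_ge0.
rewrite cnM ler_wpM2l ?cn_ge0// /mono /mi_deg -expr_sum cnX cn_real.
by rewrite ger0_norm.
Qed.

Lemma sum_cn_cvg0 (R : realType) (I : eqType) (f : I -> nat -> R[i]) (g : I -> R[i])
    (w : I -> R) (s : seq I) :
  (forall a, 0 <= w a) -> (forall a, f a @ \oo --> g a) ->
  forall e : R, 0 < e -> exists N, forall k, (N <= k)%N ->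
    \sum_(a <- s) cn (f a k - g a) * w a <= e.
Proof.
move=> w0 fg; elim: s => [|a s IH] e e0.
  by exists 0%N => k _; rewrite big_nil ltW.
have e2 : 0 < e / 2 by rewrite divr_gt0.
have w1 : 0 < w a + 1 by rewrite ltr_wpDl.
have [[N1 H1] [N2 H2]] := (IH _ e2, (cvgCP _ _).1 (fg a) _ (divr_gt0 e2 w1)).
exists (maxn N1 N2) => k; rewrite geq_max => /andP[/H1 {}H1 /H2 {}H2].
rewrite big_cons; move: H2; rewrite ler_pdivlMr// mulrDr mulr1 => H2.
have := cn_ge0 (f a k - g a); lra.
Qed.

Section TreeSeries.
Context {R : realType} {n : nat} (h : 'I_n -> mi n -> R[i]).
Context {u0 beta M q y : R}.
Hypothesis u1 : 1 < u0.
Hypothesis beta_ge : forall i d,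
  \sum_(l < d) u0 ^+ l.+1 * \sum_j cn ((Amat h ^+ l) i j) <= beta.
Hypothesis y0 : 0 < y.
Hypothesis q0 : 0 <= q.
Hypothesis hq : forall i d,
  \sum_(b <- mis d | (1 < mi_deg b)%N) cn (h i b) * M ^+ mi_deg b <= q.
Hypothesis bM : beta * (y + q) <= M.
Implicit Types (i j : 'I_n) (a : mi n) (x : 'I_n -> R[i]) (s : seq (mi n)).

Let u0_gt0 : 0 < u0. Proof. exact: lt_trans u1. Qed.

Lemma l1norm_tree_poly d i : l1norm (vert_leaf_weight u0 y) (tree_poly h d i) <= M.
Proof.
have w0 k : 0 <= @vert_leaf_weight R n u0 y k.
  by rewrite /vert_leaf_weight; case: unlift => [?|] /=; exact: ltW.
have nu_var k : l1norm (vert_leaf_weight u0 y) (poly_var k) = vert_leaf_weight u0 y k.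
  rewrite l1normX /mnm_weight (bigD1 k)//= mpoly.mnm1E eqxx expr1 big1 ?mulr1// => l.
  by rewrite mpoly.mnm1E eq_sym => /negbTE ->.
have nu1 : l1norm (@vert_leaf_weight R n u0 y) 1 <= 1 by rewrite l1norm1.
apply: (tree_sum_bound (l1norm_ge0 w0) (l1norm0 _) nu1 (l1normD w0) (l1normM w0)
  (l1normZ w0) _ beta_ge (ltW y0) _ q0 hq bM) => [|j].
  by rewrite nu_var /vert_leaf_weight unlift_none.
by rewrite nu_var /vert_leaf_weight liftK.
Qed.

(** The index is needed: for n = 0 the hypotheses do not force [M] to be nonnegative. *)
Lemma M_ge0 : 'I_n -> 0 <= M.
Proof.
move=> i; apply: le_trans (l1norm_tree_poly 0 i); apply: l1norm_ge0 => k.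
by rewrite /vert_leaf_weight; case: unlift => [?|] /=; exact: ltW.
Qed.

Lemma leaf_coef_gpart d i N s : (N <= d)%N -> uniq s ->
  \sum_(a <- s) cn (leaf_coef h d i a - gpart h i a N) * y ^+ mi_deg a <= M / u0 ^+ N.
Proof.
move=> Nd su; apply: leaf_coef_dist => //; [exact: ltW|exact: ltW|].
exact: l1norm_tree_poly.
Qed.

(** For d < N, [otrees d] may miss trees counted by [gpart] at [N]. The detour through [gpart] at
    [d] and [leaf_coef] at [N] costs three terms. *)
Lemma leaf_coef_gpart3 d i N s : (d <= N)%N -> uniq s ->
  \sum_(a <- s) cn (leaf_coef h d i a - gpart h i a N) * y ^+ mi_deg a <=
  3 * M / u0 ^+ d.
Proof.
move=> dN su.
have H1 := leaf_coef_gpart i (leqnn d) su; have H2 := leaf_coef_gpart i dN su.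
have H3 : \sum_(a <- s) cn (leaf_coef h N i a - gpart h i a N) * y ^+ mi_deg a <=
    M / u0 ^+ d.
  apply: le_trans (leaf_coef_gpart i (leqnn N) su) _.
  rewrite ler_wpM2l ?(M_ge0 i)// lef_pV2 ?posrE ?exprn_gt0//.
  by rewrite ler_weXn2l// ltW.
apply: le_trans (_ : _ <= M / u0 ^+ d + M / u0 ^+ d + M / u0 ^+ d) _; last lra.
apply: le_trans (lerD (lerD H1 H2) H3); rewrite -!big_split /=.
apply: ler_sum => a _; rewrite -!mulrDl ler_wpM2r ?exprn_ge0 ?(ltW y0)//.
apply: le_trans (cn_distD (leaf_coef h N i a) _ _) _; rewrite lerD2r.
apply: le_trans (cn_distD (gpart h i a d) _ _) _; rewrite lerD2l.
by rewrite cn_distC.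
Qed.

Lemma gpart_cauchy i a : exists g : R[i], gpart h i a @ \oo --> g.
Proof.
apply: cauchyC => e e0; have ya : 0 < y ^+ mi_deg a by rewrite exprn_gt0.
(* Two comparisons with [leaf_coef] at [N], each costing 3 * M / u0^N. *)
have [N HN] := geometric_small (6 * M) u1 (mulr_gt0 e0 ya).
exists N => k l Nk Nl; rewrite -(ler_pM2r ya); apply: le_trans (HN N (leqnn N)).
have Hk := leaf_coef_gpart3 i (s := [:: a]) Nk isT.
have Hl := leaf_coef_gpart3 i (s := [:: a]) Nl isT.
rewrite !big_seq1 in Hk Hl.
apply: le_trans (ler_wpM2r (ltW ya) (cn_distD (leaf_coef h N i a) _ _)) _.
by rewrite mulrDl (cn_distC (gpart h i a k)); apply: le_trans (lerD Hk Hl) _; lra.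
Qed.

Context {g : 'I_n -> mi n -> R[i]}.
Hypothesis gpart_cvg : forall i a, gpart h i a @ \oo --> g i a.

Lemma leaf_coef_cvg d i s : uniq s ->
  \sum_(a <- s) cn (leaf_coef h d i a - g i a) * y ^+ mi_deg a <= 3 * M / u0 ^+ d.
Proof.
move=> su; apply/ler_addgt0Pr => e e0.
have yge0 a : 0 <= y ^+ mi_deg a by rewrite exprn_ge0// ltW.
have [N HN] := sum_cn_cvg0 s yge0 (@gpart_cvg i) e0.
have H1 := HN _ (leq_maxl N d).
have H2 := leaf_coef_gpart3 i (leq_maxr N d) su.
apply: le_trans (lerD H2 H1); rewrite -big_split /=; apply: ler_sum => a _.
by rewrite -mulrDl ler_wpM2r ?cn_distD.
Qed.

Lemma nz_tree_coef i : nz (g i) = g i.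
Proof.
apply/funext => a; rewrite /nz; case: eqVneq => // ->.
apply: cvgC_uniq (@gpart_cvg i (mi0 n)); apply/cvgCP => e e0; exists 0%N => k _.
rewrite (gpart_otrees h i _ (leqnn k)) big1 ?subrr ?cn0 ?ltW// => t /andP[].
by rewrite (negbTE (leaftype_neq0 t)).
Qed.

Section Evaluation.
Context {x : 'I_n -> R[i]}.
Hypothesis xy : forall j, cn (x j) <= y.

Definition tree_val d i : R[i] := tree_sum h (1 : R[i]^o) x d i.

Lemma tree_valS d i :
  tree_val d.+1 i = x i + psum (nz (h i)) (tree_val d) d.+1.
Proof. by rewrite psum_nz /tree_val tree_sumS mul1r. Qed.

(** The second instance of the seminorm bound: the modulus on the complex numbers, with u = 1 <=
    u0. *)
Lemma tree_val_bound d i : cn (tree_val d i) <= M.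
Proof.
have nu1 : cn (1 : R[i]) <= 1 by rewrite cn1.
have nuM (v w : R[i]) : cn (v * w) <= cn v * cn w by rewrite cnM.
have nu_u : cn (1 : R[i]) <= u0 by rewrite cn1 ltW.
exact: (tree_sum_bound (V := R[i]^o) (nu := @cn R) (@cn_ge0 R) (@cn0 R) nu1 (@cnD R)
  nuM nuM nu_u beta_ge (ltW y0) xy q0 hq bM).
Qed.

Lemma tree_valE d i : exists D, forall N, (D <= N)%N ->
  tree_val d i = \sum_(a <- mis N) leaf_coef h d i a * mono x a.
Proof.
exists (\sum_(t <- otrees d i) mi_deg (leaftype t))%N => N DN.
under eq_bigr => a _ do rewrite /leaf_coef mulr_suml.
rewrite (exchange_big_dep xpredT)//= /tree_val /tree_sum big_seq [RHS]big_seq.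
apply: eq_bigr => t td; rewrite -big_filter (perm_big [:: leaftype t]).
  rewrite big_seq1 /tree_term expr1n mul1r; congr (_ * _).
  by apply: eq_bigr => j _; rewrite ffunE.
apply: uniq_perm => [|//|a]; first exact: filter_uniq (mis_uniq N).
rewrite mem_filter mem_mis inE eq_sym; apply: andb_idr => /eqP ->.
by apply: leq_trans DN; rewrite (perm_big _ (perm_to_rem td)) big_cons leq_addr.
Qed.

Lemma cn_mono_weight c a : cn (c * mono x a) <= cn c * y ^+ mi_deg a.
Proof. by rewrite cnM ler_wpM2l ?cn_ge0 ?cn_mono_le. Qed.

Lemma tree_coef_conv i : ps_conv (g i) x.
Proof.
(* At d = 0 there are no trees, so the distance estimate bounds the coefficients [g] themselves. *)
apply/abs_summableP; exists (3 * M / u0 ^+ 0) => s su.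
apply: le_trans (leaf_coef_cvg 0 i su); apply: ler_sum => a _.
apply: le_trans (cn_mono_weight _ _) _; rewrite /leaf_coef big_nil.
by rewrite sub0r cnN.
Qed.

Lemma tree_val_dist d i : cn (ps_val (g i) x - tree_val d i) <= 3 * M / u0 ^+ d.
Proof.
have [D HD] := tree_valE d i.
apply: (cvgC_le (N := D) (ps_conv_cvg (tree_coef_conv i))) => N DN.
rewrite psumE (HD N DN) -sumrB; apply: le_trans (cn_sum _ _ _) _.
apply: le_trans (leaf_coef_cvg d i (mis_uniq N)); apply: ler_sum => a _.
by rewrite -mulrBl cn_distC; exact: cn_mono_weight.
Qed.

Lemma tree_val_cvg i : (tree_val^~ i) @ \oo --> ps_val (g i) x.
Proof.
apply/cvgCP => e e0; have [N HN] := geometric_small (3 * M) u1 e0.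
by exists N => k /HN; apply: le_trans; rewrite cn_distC tree_val_dist.
Qed.

Lemma Gmap_bound i : cn (Gmap g x i) <= M.
Proof.
rewrite /Gmap nz_tree_coef -[X in cn X]subr0.
apply: (cvgC_le (N := 0) (@tree_val_cvg i)) => k _.
by rewrite subr0 tree_val_bound.
Qed.

Lemma Fmap_Gmap (rho H : R) i : 0 < rho -> 0 <= H ->
  (forall i s, uniq s ->
    \sum_(a <- s | a != mi0 n) cn (h i a) * rho ^+ mi_deg a <= H) ->
  M <= rho / 4 -> ps_conv (nz (h i)) (Gmap g x) ->
  Fmap h (Gmap g x) i = x i.
Proof.
move=> rho0 H0 hH M4 hG; rewrite /Fmap.
have Gx : Gmap g x i = ps_val (g i) x by rewrite /Gmap nz_tree_coef.
apply/eqP; rewrite -subr_eq0 addrAC subr_eq0; apply/eqP.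
(* In [tree_valS] the degree cutoff and the argument vary together. A Lipschitz bound independent of
   the cutoff replaces [tree_val k] by its limit; the shift matches the cutoff [d.+1] there. *)
apply: (@cvgC_uniq _ (fun d => psum (nz (h i)) (Gmap g x) d.+1)); last first.
  by have /cvgCP Hc := ps_conv_cvg hG; apply/cvgCP => e /Hc[N HN];
    exists N => k Nk; apply: HN; exact: leqW.
apply/cvgCP => e e0.
have [N1 H1] := geometric_small (3 * M) u1 (divr_gt0 e0 (ltr0n _ 2)).
have [N2 H2] := geometric_small (rho^-1 * H * (3 * M)) u1 (divr_gt0 e0 (ltr0n _ 2)).
exists (maxn N1 N2) => k; rewrite geq_max => /andP[Nk1 /H2 {}H2].
have {}H1 := H1 _ (leqW Nk1).
have D1 := tree_val_dist k.+1 i.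
have dk j : cn (Gmap g x j - tree_val k j) <= 3 * M / u0 ^+ k.
  by rewrite /Gmap nz_tree_coef tree_val_dist.
have M0 := M_ge0 i.
have D2 : cn (psum (nz (h i)) (Gmap g x) k.+1 - psum (nz (h i)) (tree_val k) k.+1) <=
    rho^-1 * H * (3 * M / u0 ^+ k).
  apply: (psum_lipschitz rho0 H0 hH M4 Gmap_bound (tree_val_bound k) dk M0).
  by rewrite !mulr_ge0 ?invr_ge0 ?exprn_ge0// ltW.
rewrite Gx.
have -> : psum (nz (h i)) (Gmap g x) k.+1 - (ps_val (g i) x - x i) =
    (psum (nz (h i)) (Gmap g x) k.+1 - psum (nz (h i)) (tree_val k) k.+1) -
    (ps_val (g i) x - tree_val k.+1 i).
  by rewrite tree_valS; ring.
by apply: le_trans (cnB _ _) _; rewrite mulrA in D2; lra.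
Qed.

End Evaluation.
End TreeSeries.

(** * Choice of the radii and conclusion *)

Unset Implicit Arguments.

Theorem theorem2p1 (R : realType) (n : nat) (h : 'I_n -> mi n -> R[i]) :
  (* the series sum_k A^k converges (entrywise) *)
  (forall i j : 'I_n,
     cvg ((fun N : nat => (\sum_(k < N) Amat h ^+ k) i j) @ \oo)) ->
  (* F converges on an open neighbourhood (a polydisc) of the origin *)
  (exists r : R, 0 < r /\
     forall x, polydisc r x -> forall i, ps_conv (nz (h i)) x) ->
  exists g : 'I_n -> mi n -> R[i],
    (* the tree sums defining g_{i,alpha} converge, to g_{i,alpha} *)
    (forall (i : 'I_n) (a : mi n), a != mi0 n ->
       gpart h i a @ \oo --> g i a) /\
    (* G = (sum_{alpha<>0} g_{i,alpha} X^alpha)_i is an analytic inverse of F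
       near the origin *)
    exists s t : R, 0 < s /\ 0 < t /\
      (forall x, polydisc s x ->
         (forall i, ps_conv (nz (g i)) x) /\
         (forall i, ps_conv (nz (h i)) (Gmap g x)) /\
         (forall i, Fmap h (Gmap g x) i = x i)) /\
      (forall y, polydisc t y ->
         (forall i, ps_conv (nz (h i)) y) /\
         polydisc s (Fmap h y) /\
         (forall i, Gmap g (Fmap h y) i = y i)).
Proof.
move=> Acv [r [r0 hcv]].
have [H H0 hH] := majorant_exists r0 hcv.
have [u0 [beta [u1 beta0 beta_ge]]] := neumann_geometric Acv.
pose rho := r / 2; have rho0 : 0 < rho by rewrite divr_gt0.
(* The first bound is for the degree weights. The second gives beta * M * H / rho^2 <= 1/8, as
   [Msmall] requires; H + 1 avoids division by 0. *)
pose M := Num.min (rho / 4) (rho ^+ 2 / (8 * beta * (H + 1))).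
have H1 : 0 < H + 1 by lra.
have M_gt0 : 0 < M by rewrite lt_min !divr_gt0 ?mulr_gt0 ?exprn_gt0.
have M4 : M <= rho / 4 by rewrite ge_min lexx.
have Mr : M <= rho by lra.
have MH : 8 * (beta * (M / rho ^+ 2 * H)) <= 1.
  have : M <= rho ^+ 2 / (8 * beta * (H + 1)) by rewrite ge_min lexx orbT.
  rewrite ler_pdivlMr ?mulr_gt0// => MbH.
  have -> : 8 * (beta * (M / rho ^+ 2 * H)) = 8 * beta * M * H / rho ^+ 2 by ring.
  rewrite ler_pdivrMr ?exprn_gt0// mul1r; apply: le_trans MbH.
  have := mulr_gt0 beta0 M_gt0; nra.
(* So beta * y = M / 2, leaving the other half of [M] for the nonlinear terms. *)
pose y := M / (2 * beta); have y0 : 0 < y by rewrite divr_gt0 ?mulr_gt0.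
pose q := M ^+ 2 / rho ^+ 2 * H.
have q0 : 0 <= q by rewrite mulr_ge0// divr_ge0 ?exprn_ge0 ?(ltW rho0) ?(ltW M_gt0).
have hq i d := majorant_quadratic rho0 hH i d (ltW M_gt0) Mr.
have bM : beta * (y + q) <= M.
  have -> : beta * (y + q) = M / 2 + M * (beta * (M / rho ^+ 2 * H)).
    by rewrite /y /q; field; rewrite !gt_eqF.
  nra.
have Msmall : beta * (2 * M / rho ^+ 2 * H) <= 1 / 4.
  have -> : beta * (2 * M / rho ^+ 2 * H) = 2 * (beta * (M / rho ^+ 2 * H)) by ring.
  lra.
have hM z : (forall j, cn (z j) <= M) -> forall i, ps_conv (nz (h i)) z.
  move=> zM; apply: hcv => j; rewrite lt_normC; apply: le_lt_trans (zM j) _.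
  by rewrite /rho in M4; lra.
have /choice[g0 Hg0] : forall ia : 'I_n * mi n,
    exists g : R[i], gpart h ia.1 ia.2 @ \oo --> g.
  by move=> [i a]; exact: (gpart_cauchy u1 beta_ge y0 q0 hq bM).
pose g i a := g0 (i, a).
have Hg i a : gpart h i a @ \oo --> g i a := Hg0 (i, a).
have GM z : (forall j, cn (z j) <= y) -> forall i, cn (Gmap g z i) <= M.
  by move=> zy i; exact: (Gmap_bound u1 beta_ge y0 q0 hq bM Hg zy).
have FG z : (forall j, cn (z j) <= y) -> forall i, Fmap h (Gmap g z) i = z i.
  move=> zy i; apply: (Fmap_Gmap u1 beta_ge y0 q0 hq bM Hg zy rho0 H0 hH M4).
  by apply: hM; exact: GM.
(* On this polydisc F has modulus at most t * (1 + H / rho), so it maps into the domain of G; t <= M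
   keeps the point where F is injective. *)
pose t := Num.min M (y / (1 + rho^-1 * H)).
have L0 : 0 <= rho^-1 * H by rewrite mulr_ge0 ?invr_ge0 ?(ltW rho0).
have L1 : 0 < 1 + rho^-1 * H by lra.
have t0 : 0 < t by rewrite lt_min M_gt0 divr_gt0.
have tM : t <= M by rewrite ge_min lexx.
have ty : t + t / rho * H <= y.
  have : t <= y / (1 + rho^-1 * H) by rewrite ge_min lexx orbT.
  by rewrite ler_pdivlMr// mulrDr mulr1 mulrA.
exists g; split=> [i a _|]; first exact: Hg.
exists y, t; split=> //; split=> //; split=> [x xy|z zt].
  have {}xy j : cn (x j) <= y by rewrite ltW// -lt_normC; exact: xy.
  split=> [i|]; last by split=> i; [apply: hM; exact: GM|exact: FG].
  rewrite (nz_tree_coef Hg); exact: (tree_coef_conv u1 beta_ge y0 q0 hq bM Hg xy).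
have {}zt j : cn (z j) < t by rewrite -lt_normC; exact: zt.
have zM j : cn (z j) <= M by exact: le_trans (ltW (zt j)) tM.
have hz := hM _ zM.
have Fz j : cn (Fmap h z j) < y.
  apply: le_lt_trans (cnB _ _) _; apply: lt_le_trans ty; apply: ltr_leD => //.
  rewrite -[X in cn X]subr0; apply: (cvgC_le (N := 0) (ps_conv_cvg (hz j))) => k _.
  rewrite subr0 psum_nz; apply: le_trans (cn_sum _ _ _) _.
  under eq_bigr => a _ do rewrite cnM.
  apply: (majorant_sum (rho := rho) (h := h)); rewrite ?mis_uniq ?divr_ge0 ?ltW//.
  move=> a a0; split=> //; apply: le_trans (cn_mono_le _ (fun j => ltW (zt j))) _.
  move: a0; rewrite -mi_deg_eq0; case: (mi_deg a) => // k' _.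
  rewrite !exprS mulrA mulfVK ?gt_eqF// ler_wpM2l ?(ltW t0)//.
  by rewrite lerXn2r ?nnegrE ?(ltW t0) ?(ltW rho0)// (le_trans tM).
split=> //; split=> [j|i]; first by rewrite lt_normC.
have Fzy j : cn (Fmap h z j) <= y by exact: ltW.
(* Both G(F(z)) and z have coordinates of modulus at most [M], and F sends both to F(z). *)
apply: (Fmap_injective rho0 H0 hH Acv (ltW u1) (ltW beta0) beta_ge (ltW M_gt0) M4
  Msmall (GM _ Fzy) zM (hM _ (GM _ Fzy)) hz) => j.
exact: FG.
Qed.
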